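(* Let $\theta>0$. For given $0<\theta_1^*,\theta_2^*\le 1$, there exists a unique (in law) sequence of independent $\{0,1\}$-valued random variables $\xi=(\xi_i)_{i=1}^\infty$, with $$\mathbb{P}_\theta(\xi_i=0)=\frac{i-1}{i-1+\theta_i^*},$$ where $\theta_i^*=\theta\left(\frac{\theta}{i-2}+1\right)$ for $i\ge4$ and $\theta_3^*=\theta$, such that for any $n\in\mathbb{N}$ with $n\ge4$ and any $(a_n,\dots,a_1)\in\Delta_n$, letting $\xi^n=(\xi_n,\dots,\xi_1)$, $$\mathbb{P}_\theta(\eta_n^n=a_n,\dots,\eta_1^n=a_1)=\mathbb{P}_\theta(\xi_n=a_n,\dots,\xi_1=a_1\mid\xi^{n}\in\Delta_n).$$ In addition, for $n\ge 3$, $$\delta_n(\theta):=\mathbb{P}_\theta(\xi^n\in\Delta_n)=\frac{(n-1)!\,(\theta^2+\theta+2)\,(\theta+2)_{(n-3)}}{(1+\theta^*_2)(\theta+2)\prod_{k=1}^{n-2}\bigl(k(k+1)+\theta(\theta+k)\bigr)},$$ while $\delta_1=0$ and $\delta_2=\mathbb{P}(\xi_2=0)=1/(1+\theta^*_2)$. Also, $$\lim_{n\to\infty}\delta_n(\theta)=\frac{\theta^2+\theta+2}{1+\theta^*_2}\,B(z_1(\theta),z_2(\theta)),$$ where $z_1(\theta)=\frac{3+\theta-\sqrt{(1-\theta)(1+3\theta)}}{2}$ and $z_2(\theta)=\frac{3+\theta+\sqrt{(1-\theta)(1+3\theta)}}{2}$.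
   Context: Playground game process: fix $\theta>0$ and put $p_1=0$, $p_2=1$, $p_i=\frac{i-1}{i-1+\theta}$ for $i\ge 3$, $q_i=1-p_i$. For $n\ge 2$, $\eta^{n,\theta}=(\eta^n_{n+1}=1,\eta^n_n,\dots,\eta^n_1)$ is the $\{0,1\}$-valued inhomogeneous Markov chain, run in decreasing index and started from $\eta^n_{n+1}=1$, such that $\eta^n_n=0$ a.s., $\eta^n_1=1$ a.s., and for $2\le r\le n-1$: $\mathbb{P}(\eta^n_r=0\mid\eta^n_{r+1}=0)=p_r$, $\mathbb{P}(\eta^n_r=1\mid\eta^n_{r+1}=0)=q_r$, $\mathbb{P}(\eta^n_r=0\mid\eta^n_{r+1}=1)=1$. For $j\in\mathbb{N}$, $\Delta_j=\{(a_j,\dots,a_1)\in\{0,1\}^j: a_1=1,\ a_j+\sum_{i=1}^{j-1}a_ia_{i+1}=0\}$. $x_{(m)}=x(x+1)\cdots(x+m-1)$, $x_{(0)}=1$. $B(z,w)=\Gamma(z)\Gamma(w)/\Gamma(z+w)$ is the Beta function for complex $z,w$ with positive real parts. *)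

(* Defs.v *)
From HB Require Import structures.
From mathcomp Require Import all_boot all_order all_algebra.
From mathcomp Require Import all_classical all_reals all_analysis.
From mathcomp Require Import complex.

Set Implicit Arguments.
Unset Strict Implicit.
Unset Printing Implicit Defensive.

Import Order.TTheory GRing.Theory Num.Theory.
Import numFieldNormedType.Exports.

Local Open Scope classical_set_scope.
Local Open Scope ring_scope.
Local Open Scope complex_scope.

(* Throughout, the values 0 and 1 of a {0,1}-valued random variable are the
   booleans [false] and [true].  All words and sequences are indexed from 1;
   the entry of index 0 is never used. *)

Section Probability.
Context {R : realType} {d : measure_display} {T : measurableType d}.
Variable P : probability T R.

(* P(A | B); only meaningful when P(B) != 0. *)
Definition cond_prob (A B : set T) : R := fine (P (A `&` B)) / fine (P B).

(* The event (X_m, ..., X_l) = (a_m, ..., a_l). *)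
Definition word_event (X : nat -> {RV P >-> bool}) (l m : nat)
    (a : nat -> bool) : set T :=
  [set w | forall i, (l <= i <= m)%N -> X i w = a i].

Definition independent_seq (X : nat -> {RV P >-> bool}) : Prop :=
  forall (s : seq nat) (B : nat -> set bool), uniq s -> all (leq 1) s ->
    P [set w | forall i, i \in s -> B i (X i w)] =
    (\prod_(i <- s) P (X i @^-1` B i))%E.

End Probability.

(* The product sigma-algebra on {0,1}^{1,2,...}. *)
Definition measurable_seq : set_system (nat -> bool) :=
  <<s [set A | exists i b, (1 <= i)%N /\ A = [set x | x i = b]] >>.

Definition same_law {R : realType} {d1 d2 : measure_display}
    {T1 : measurableType d1} {T2 : measurableType d2}
    (P1 : probability T1 R) (P2 : probability T2 R)
    (X1 : nat -> {RV P1 >-> bool}) (X2 : nat -> {RV P2 >-> bool}) : Prop :=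
  forall A, measurable_seq A ->
    P1 [set w | A (fun i => X1 i w)] = P2 [set w | A (fun i => X2 i w)].

Section Playground.
Context {R : realType}.
Variable theta : R.

Definition play_p (i : nat) : R :=
  if (i <= 1)%N then 0 else if i == 2%N then 1
  else (i.-1)%:R / ((i.-1)%:R + theta).

Definition play_q (i : nat) : R := 1 - play_p i.

(* [eta] run from index n.+1 down to index 1.  The Markov property and the
   transition probabilities are imposed when the conditioning event is not
   null. *)
Definition playground_chain {d : measure_display} {T : measurableType d}
    (P : probability T R) (n : nat) (eta : nat -> {RV P >-> bool}) : Prop :=
  [/\ P (eta n.+1 @^-1` [set true]) = 1%E,
      P (eta n @^-1` [set false]) = 1%E /\ P (eta 1%N @^-1` [set true]) = 1%E,
      forall (r : nat) (a : nat -> bool), (1 <= r <= n)%N ->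
        P (word_event eta r.+1 n.+1 a) != 0%E ->
        cond_prob P (eta r @^-1` [set a r]) (word_event eta r.+1 n.+1 a) =
        cond_prob P (eta r @^-1` [set a r]) (eta r.+1 @^-1` [set a r.+1]),
      forall r : nat, (2 <= r < n)%N ->
        P (eta r.+1 @^-1` [set false]) != 0%E ->
        cond_prob P (eta r @^-1` [set false]) (eta r.+1 @^-1` [set false])
          = play_p r /\
        cond_prob P (eta r @^-1` [set true]) (eta r.+1 @^-1` [set false])
          = play_q r
    & forall r : nat, (2 <= r < n)%N ->
        P (eta r.+1 @^-1` [set true]) != 0%E ->
        cond_prob P (eta r @^-1` [set false]) (eta r.+1 @^-1` [set true]) = 1].

(* Words (a_j, ..., a_1): only the entries a 1, ..., a j matter. *)
Definition Delta (j : nat) : set (nat -> bool) :=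
  [set a | a 1%N = true /\ (a j + \sum_(1 <= i < j) a i * a i.+1 = 0)%N].

Definition theta_star (theta1 theta2 : R) (i : nat) : R :=
  if (i <= 1)%N then theta1 else if i == 2%N then theta2
  else if i == 3%N then theta else theta * (theta / (i.-2)%:R + 1).

Section Sequence.
Context {d : measure_display} {T : measurableType d} {P : probability T R}.
Variable xi : nat -> {RV P >-> bool}.

Definition Delta_event (n : nat) : set T :=
  [set w | Delta n (fun i => xi i w)].

Definition delta (n : nat) : R := fine (P (Delta_event n)).

(* P(xi_i = 0) = (i - 1) / (i - 1 + t_i) *)
Definition marginal (t : nat -> R) (i : nat) : Prop :=
  P (xi i @^-1` [set false]) = ((i.-1)%:R / ((i.-1)%:R + t i))%:E.

(* For all n >= 4, the law of (eta^n_n, ..., eta^n_1) is that of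
   (xi_n, ..., xi_1) conditioned on Delta_n. *)
Definition represents (dQ : nat -> measure_display)
    (TQ : forall n, measurableType (dQ n))
    (Q : forall n, probability (TQ n) R)
    (eta : forall n : nat, nat -> {RV (Q n) >-> bool}) : Prop :=
  forall n : nat, (4 <= n)%N ->
    P (Delta_event n) != 0%E /\
    forall a, Delta n a ->
      fine (Q n (word_event (eta n) 1 n a)) =
      cond_prob P (word_event xi 1 n a) (Delta_event n).

End Sequence.
End Playground.

(* x_(m) = x (x + 1) ... (x + m - 1) *)
Definition rising {R : realType} (x : R) (m : nat) : R :=
  \prod_(k < m) (x + k%:R).

Section ComplexBeta.
Context {R : realType}.

Definition cexp (z : R[i]) : R[i] :=
  (expR (complex.Re z))%:C * (cos (complex.Im z) +i* sin (complex.Im z)).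

(* Principal power t ^ z for t > 0. *)
Definition cpow (t : R) (z : R[i]) : R[i] := cexp (z * (ln t)%:C).

Definition Gamma_integrand (z : R[i]) (t : R) : R[i] :=
  cpow t (z - 1) * (expR (- t))%:C.

(* Euler's integral, for Re z > 0; the complex integral is taken
   componentwise. *)
Definition Gamma (z : R[i]) : R[i] :=
  (\int[lebesgue_measure]_(t in `]0, +oo[) complex.Re (Gamma_integrand z t)) +i*
  (\int[lebesgue_measure]_(t in `]0, +oo[) complex.Im (Gamma_integrand z t)).

Definition Beta (z w : R[i]) : R[i] := Gamma z * Gamma w / Gamma (z + w).

(* [sqrtc] is the principal complex square root: the argument is negative when
   theta > 1, and z1, z2 are then complex conjugates. *)
Definition z1 (theta : R) : R[i] :=
  ((3 + theta)%:C - sqrtc ((1 - theta) * (1 + 3 * theta))%:C) / 2.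

Definition z2 (theta : R) : R[i] :=
  ((3 + theta)%:C + sqrtc ((1 - theta) * (1 + 3 * theta))%:C) / 2.

End ComplexBeta.

(* Main.v *)
(* A word of [Delta n] is a path of the playground chain: its probability is the
   product of the transition probabilities, i.e. [\prod_(2 <= r < n) p_r] times
   the product over the ones of [q_r / (p_r p_(r-1))].  The chain is therefore
   the sequence of independent bits with odds [P(xi_r = 1) / P(xi_r = 0) =
   q_r / (p_r p_(r-1))] conditioned on [Delta n], and comparing the word
   [0 ... 0 1] with the words having one more 1 shows that no other odds will do.
   Splitting [Delta n.+1] according to the entry of index [n] gives a two-step
   recursion for [delta_n], solved by the announced product.

   For the limit, [k (k + 1) + theta (theta + k) = (z1 + k - 1) (z2 + k - 1)], so
   that [delta_n] is, up to elementary factors, a quotient of three products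
   [m! m^z / (z (z + 1) ... (z + m))], at [z1], [z2] and [z1 + z2].  As the real
   parts of [z1] and [z2] exceed 1, Gauss's formula follows by dominated
   convergence from
   [\int_0^c t^(z-1) (1 - t/c)^m dt = c^z m! / (z (z + 1) ... (z + m))],
   where the step from [m] to [m + 1] is the linear relation
   [J_(m+1) z = J_m z - J_m (z + 1) / c] and the case [m = 0] is the fundamental
   theorem of calculus for an integrand continuous on [[0, c]]. *)

Require Import Defs.
From HB Require Import structures.
From mathcomp Require Import all_boot all_order all_algebra.
From mathcomp Require Import all_classical all_reals all_analysis.
From mathcomp Require Import complex measurable_realfun ring lra zify.

Import Order.TTheory GRing.Theory Num.Theory.
Import numFieldNormedType.Exports.

Local Open Scope classical_set_scope.
Local Open Scope ring_scope.
Local Open Scope complex_scope.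

(** * Independent bits with prescribed laws *)

Definition bern {R : realType} (p : R) (B : set bool) : R :=
  p * (false \in B)%:R + (1 - p) * (true \in B)%:R.

(* Digits of [u] in the nested subdivision that cuts each interval [[l, l + w[]
   of level [n] at the proportion [s n]; under the uniform law on [[0, 1[] they
   are independent and equal to [false] with probability [s n]. *)
Fixpoint unit_bit {R : realType} (s : nat -> R) (n : nat) (l w u : R) : bool :=
  match n with
  | 0 => l + w * s 0 <= u
  | n.+1 => if u < l + w * s 0 then unit_bit (s \o S) n l (w * s 0) u
            else unit_bit (s \o S) n (l + w * s 0) (w * (1 - s 0)) u
  end.

Section BernoulliSequence.
Context {R : realType}.

(** The interval is arbitrary so that inductions on [n] can descend into the two pieces of the
    subdivision. *)
Definition unit_cyl (s : nat -> R) (n : nat) (B : nat -> set bool) (l w : R) :=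
  [set u | l <= u < l + w /\ forall i, (i < n)%N -> B i (unit_bit s i l w u)].

Lemma unit_cylS (s : nat -> R) n B (l w : R) :
  (forall i, 0 <= s i <= 1) -> 0 <= w ->
  unit_cyl s n.+1 B l w =
  (if false \in B 0%N
   then unit_cyl (s \o S) n (B \o S) l (w * s 0%N) else set0) `|`
  (if true \in B 0%N
   then unit_cyl (s \o S) n (B \o S) (l + w * s 0%N) (w * (1 - s 0%N))
   else set0).
Proof.
move=> s01 w0; have /andP[s0 s1] := s01 0%N.
have ws0 : 0 <= w * s 0%N by exact: mulr_ge0.
have ws1 : w * s 0%N <= w by rewrite ler_piMr.
have lwE : l + w * s 0%N + w * (1 - s 0%N) = l + w by ring.
apply/seteqP; split => [u [/andP[lu uw] hu]|u].
- have [uls|lsu] := ltP u (l + w * s 0%N); [left|right].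
  + have /= := hu 0%N isT; rewrite leNgt uls /= => /mem_set ->.
    split; first by rewrite lu.
    by move=> i ni; have /= := hu i.+1 ni; rewrite uls.
  + have /= := hu 0%N isT; rewrite lsu /= => /mem_set ->.
    split; first by rewrite lsu lwE.
    by move=> i ni; have /= := hu i.+1 ni; rewrite ltNge lsu.
- move=> [|]; case: ifPn => // /set_mem B0 [/andP[lu uw] hu]; split.
  + by rewrite lu (lt_le_trans uw)// lerD2l.
  + by move=> [_|i ni] /=; [rewrite leNgt uw|rewrite uw; exact: hu].
  + by move: uw; rewrite lwE => ->; rewrite (le_trans _ lu)// lerDl.
  + by move=> [_|i ni] /=; [rewrite lu|rewrite ltNge lu; exact: hu].
Qed.

Lemma measurable_unit_cyl (s : nat -> R) n B (l w : R) :
  (forall i, 0 <= s i <= 1) -> 0 <= w ->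
  measurable (unit_cyl s n B l w).
Proof.
elim: n s B l w => [|n IHn] s B l w s01 w0.
  rewrite (_ : unit_cyl _ _ _ _ _ = `[l, l + w[%classic); first exact: measurable_itv.
  by apply/seteqP; split => u /=; rewrite in_itv/=; [case|split].
have /andP[s0 s1] := s01 0%N.
rewrite unit_cylS//; apply: measurableU.
- by case: ifPn => // _; apply: IHn => [i|]; [exact: s01|exact: mulr_ge0].
- case: ifPn => // _; apply: IHn => [i|]; first exact: s01.
  by apply: mulr_ge0 => //; rewrite subr_ge0.
Qed.

(** By induction through [unit_cylS]: the two pieces are disjoint, and their widths [w * s 0] and
    [w * (1 - s 0)] supply the two terms of the first [bern] factor. *)
Lemma lebesgue_measure_unit_cyl (s : nat -> R) n B (l w : R) :
  (forall i, 0 <= s i <= 1) -> 0 <= w ->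
  lebesgue_measure (unit_cyl s n B l w) =
  (w * \prod_(i < n) bern (s i) (B i))%:E.
Proof.
elim: n s B l w => [|n IHn] s B l w s01 w0.
  rewrite (_ : unit_cyl _ _ _ _ _ = `[l, l + w[%classic); last first.
    by apply/seteqP; split => u /=; rewrite in_itv/=; [case|split].
  rewrite lebesgue_measure_itv/= lte_fin ltrDl big_ord0 mulr1.
  case: ltP => [_|w0']; first by rewrite -EFinD addrAC subrr add0r.
  by congr EFin; apply/eqP; rewrite eq_le w0 w0'.
have /andP[s0 s1] := s01 0%N.
have s01' i : 0 <= (s \o S) i <= 1 by exact: s01.
have ws0 : 0 <= w * s 0%N by exact: mulr_ge0.
have ws1 : 0 <= w * (1 - s 0%N) by apply: mulr_ge0 => //; rewrite subr_ge0.
rewrite unit_cylS// measureU.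
- rewrite big_ord_recl /bern.
  rewrite (eq_bigr (fun i : 'I_n => bern ((s \o S) i) ((B \o S) i))) //.
  set F := (X in (_ + X)%E); set E := (X in (X + _)%E).
  have -> : E = (w * s 0%N * (false \in B 0%N)%:R *
      \prod_(i < n) bern ((s \o S) i) ((B \o S) i))%:E.
    rewrite /E; case: ifPn => _; last by rewrite mulr0 mul0r measure0.
    by rewrite mulr1; exact: IHn.
  have -> : F = (w * (1 - s 0%N) * (true \in B 0%N)%:R *
      \prod_(i < n) bern ((s \o S) i) ((B \o S) i))%:E.
    rewrite /F; case: ifPn => _; last by rewrite mulr0 mul0r measure0.
    by rewrite mulr1; exact: IHn.
  by rewrite -EFinD; congr EFin; ring.
- by case: ifPn => // _; exact: measurable_unit_cyl.
- by case: ifPn => // _; exact: measurable_unit_cyl.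
- apply/seteqP; split => // u [] /=.
  case: ifPn => // _ [/andP[_ u1] _]; case: ifPn => // _ [/andP[u2 _] _].
  by move: u1; rewrite ltNge u2.
Qed.

Definition unit_measure : set (measurableTypeR R) -> \bar R :=
  mrestr (@lebesgue_measure R) (measurable_itv `[0, 1[%R).

HB.instance Definition _ := Measure.on unit_measure.

Lemma unit_measure_setT : unit_measure setT = 1%E.
Proof.
rewrite /unit_measure /mrestr setTI lebesgue_measure_itv/=.
by rewrite lte_fin ltr01 oppr0 adde0.
Qed.

HB.instance Definition _ :=
  Measure_isProbability.Build _ _ _ unit_measure unit_measure_setT.

Section bits.
Variable (s : nat -> R).
Hypothesis s01 : forall i, 0 <= s i <= 1.

(** The cut-off outside [0, 1[ is invisible to [unit_measure] and makes the set where a digit is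
    [true] exactly a cylinder [unit_cyl]. *)
Definition bit (i : nat) (u : measurableTypeR R) : bool :=
  unit_bit s i 0 1 u && (0 <= u < 1).

Lemma bit_setI n (B : nat -> set bool) :
  [set u | forall i, (i < n)%N -> B i (bit i u)] `&` `[0, 1[%classic =
  unit_cyl s n B 0 1.
Proof.
rewrite /unit_cyl add0r; apply/seteqP; split => u /=; rewrite in_itv/= /bit.
  by move=> [hu u01]; split => // i /hu; rewrite u01 andbT.
by move=> [u01 hu]; split => // i /hu; rewrite u01 andbT.
Qed.

Lemma measurable_bit i : measurable_fun setT (bit i).
Proof.
apply: (@measurable_fun_bool _ _ _ _ true); rewrite setTI.
rewrite (_ : _ @^-1` _ =
    unit_cyl s i.+1 (fun j => if j == i then [set true] else setT) 0 1).
  exact: measurable_unit_cyl.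
rewrite /unit_cyl add0r; apply/seteqP; split => u /=; rewrite /bit.
  move=> /andP[ui ->]; split => // j _.
  by case: eqP => [->|//].
by move=> [-> /(_ i (ltnSn _))]; rewrite eqxx andbT.
Qed.

Lemma unit_measure_bits n (B : nat -> set bool) :
  unit_measure [set u | forall i, (i < n)%N -> B i (bit i u)] =
  (\prod_(i < n) bern (s i) (B i))%:E.
Proof.
rewrite /unit_measure /mrestr bit_setI.
by rewrite [LHS]lebesgue_measure_unit_cyl// mul1r.
Qed.

(** The indices are completed to an initial segment by trivial conditions [setT], whose [bern]
    factors are 1. *)
Lemma unit_measure_bits_seq (B : nat -> set bool) (r : seq nat) : uniq r ->
  unit_measure [set u | forall i, i \in r -> B i (bit i u)] =
  (\prod_(i <- r) bern (s i) (B i))%:E.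
Proof.
move=> ur; pose n := (\max_(i <- r) i).+1.
have rn i : i \in r -> (i < n)%N by move=> ir; rewrite ltnS (leq_bigmax_seq _ ir).
pose B' i := if i \in r then B i else setT.
rewrite (_ : [set u | _] =
    [set u | forall i, (i < n)%N -> B' i (bit i u)]); last first.
  apply/seteqP; split => u /= hu i.
    by rewrite /B'; case: ifPn => // /hu.
  by move=> ir; have := hu i (rn i ir); rewrite /B' ir.
rewrite unit_measure_bits; congr EFin; rewrite /B'.
rewrite (bigID (fun i : 'I_n => (i : nat) \in r))/= [X in _ * X]big1 ?mulr1.
  rewrite -(big_mkord (mem r) (fun i => bern (s i) (if i \in r then B i else setT))).
  rewrite -big_filter (perm_big r).
    by apply: eq_big_seq => i ->.
  apply: uniq_perm => //; first by rewrite filter_uniq// iota_uniq.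
  move=> i; rewrite mem_filter mem_index_iota /= andbC.
  by case: (boolP (i \in r)) => [/rn ->|]; rewrite ?andbF.
by move=> i /negbTE ->; rewrite /bern !in_setT !mulr1 addrC subrK.
Qed.

End bits.

Lemma exists_bernoulli_seq (s : nat -> R) : (forall i, 0 <= s i <= 1) ->
  exists (P : probability (measurableTypeR R) R) (X : nat -> {RV P >-> bool}),
  independent_seq X /\ forall i, P (X i @^-1` [set false]) = (s i)%:E.
Proof.
move=> s01.
pose X i : {RV unit_measure >-> bool} :=
  HB.pack (bit s i)
    (isMeasurableFun.Build _ _ (measurableTypeR R) bool _
       (measurable_bit s s01 i)).
have mar i B : unit_measure (X i @^-1` B) = (bern (s i) B)%:E.
  have := unit_measure_bits_seq s s01 (fun=> B) [:: i] isT.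
  rewrite big_seq1 => <-; congr unit_measure.
  apply/seteqP; split => u /=; first by move=> Bu j; rewrite inE => /eqP ->.
  by apply; rewrite mem_head.
exists unit_measure, X; split.
  move=> r B ur _; apply: etrans (unit_measure_bits_seq s s01 B r ur) _.
  rewrite -prodEFin; apply: eq_bigr => i _; exact/esym/mar.
move=> i; apply: etrans (mar i _) _.
by rewrite /bern mem_set// memNset//= mulr1 mulr0 addr0.
Qed.

End BernoulliSequence.

(** * The event [Delta] for independent bits *)

Lemma DeltaP (n : nat) (a : nat -> bool) :
  Delta n a <-> [/\ a 1%N = true, a n = false &
                    forall i, (1 <= i < n)%N -> ~~ (a i && a i.+1)].
Proof.
rewrite /Delta /=; split => [[a1 /eqP]|[a1 an an1]].
  rewrite addn_eq0 => /andP[/eqP an /eqP an1]; split => //; first by case: (a n) an.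
  move=> i ni; apply/negP => /andP[ai ai1].
  have : (a i * a i.+1 <= \sum_(1 <= i < n) a i * a i.+1)%N.
    rewrite (bigD1_seq i) ?mem_index_iota ?iota_uniq//=; exact: leq_addr.
  by rewrite an1 ai ai1.
split => //; rewrite an add0n big_nat big1// => i /an1.
by case: (a i) => //; case: (a i.+1).
Qed.

Lemma eq_Delta (n : nat) (a b : nat -> bool) : (0 < n)%N ->
  (forall i, (1 <= i <= n)%N -> a i = b i) -> Delta n a -> Delta n b.
Proof.
move=> n0 ab /DeltaP[a1 an an1]; apply/DeltaP; split.
- by rewrite -ab.
- by rewrite -ab// n0 leqnn.
- by move=> i /andP[i1 ni]; rewrite -!ab ?an1 ?i1 ?ni// ltnW.
Qed.

Lemma Delta1 (a : nat -> bool) : ~ Delta 1 a.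
Proof. by move=> /DeltaP[->]. Qed.

Lemma Delta2 (a : nat -> bool) : Delta 2 a <-> a 1%N = true /\ a 2%N = false.
Proof.
split => [/DeltaP[-> ->]//|[a1 a2]]; apply/DeltaP; split => // i i12.
have -> : i = 1%N by lia.
by rewrite a2 andbF.
Qed.

(** A one at index [n.+2] forces a zero at [n.+1], so that deleting the two top entries leaves a
    word of [Delta n.+1]. *)
Lemma DeltaS (n : nat) (a : nat -> bool) :
  Delta n.+3 a <-> a n.+3 = false /\
    (Delta n.+2 a \/ a n.+2 = true /\ Delta n.+1 a).
Proof.
split.
  move=> /DeltaP[a1 an an1]; split => //.
  case an2 : (a n.+2); [right; split => //|left]; apply/DeltaP; split => //.
  - by have := an1 n.+1; rewrite an2 andbT => /(_ _)/negbTE; apply; lia.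
  - by move=> i ni; apply: an1; lia.
  - by move=> i ni; apply: an1; lia.
move=> [an3 [/DeltaP[a1 an2 an1]|[an2 /DeltaP[a1 an an1]]]]; apply/DeltaP.
  split => // i ni; have [->|ni2] := eqVneq i n.+2; first by rewrite an2.
  by apply: an1; lia.
split => // i ni; have [->|ni2] := eqVneq i n.+2; first by rewrite an3 andbF.
have [->|ni1] := eqVneq i n.+1; first by rewrite an.
by apply: an1; lia.
Qed.

Section IndependentBits.
Context {R : realType} {d : measure_display} {T : measurableType d}.
Variables (P : probability T R) (X : nat -> {RV P >-> bool}).

Definition bit_law (s : R) (b : bool) : R := if b then 1 - s else s.

Lemma measurable_bit_event (i : nat) (B : set bool) : measurable (X i @^-1` B).
Proof. by rewrite -[X in measurable X]setTI; exact: measurable_funP. Qed.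

Lemma bit_lawE (s : R) i b : P (X i @^-1` [set false]) = s%:E ->
  P (X i @^-1` [set b]) = (bit_law s b)%:E.
Proof.
move=> Ps; case: b => //=.
have -> : X i @^-1` [set true] = ~` (X i @^-1` [set false]).
  by apply/seteqP; split => w /=; case: (X i w).
by rewrite probability_setC ?Ps//; exact: measurable_bit_event.
Qed.

Lemma measurable_word_event l m a : measurable (word_event X l m a).
Proof.
rewrite (_ : word_event X l m a =
    \bigcap_(i in [set i | (l <= i <= m)%N]) (X i @^-1` [set a i])) //.
by apply: bigcap_measurableType => i _; exact: measurable_bit_event.
Qed.

Lemma measurable_Delta_event n : (0 < n)%N -> measurable (Delta_event X n).
Proof.
suff: measurable (Delta_event X n.-1.+1) /\ measurable (Delta_event X n.-1.+2).
  by case: n => // n [].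
elim: {n}n.-1 => [|n [IH1 IH2]].
  split.
    rewrite (_ : Delta_event X 1 = set0); first exact: measurable0.
    by rewrite -subset0 => w /Delta1.
  rewrite (_ : Delta_event X 2 = X 1%N @^-1` [set true] `&` X 2%N @^-1` [set false]).
    by apply: measurableI; exact: measurable_bit_event.
  by apply/seteqP; split => w; rewrite /Delta_event /= Delta2.
split=> //.
rewrite (_ : Delta_event X n.+3 = X n.+3 @^-1` [set false] `&`
   (Delta_event X n.+2 `|` (X n.+2 @^-1` [set true] `&` Delta_event X n.+1))).
  apply: measurableI; first exact: measurable_bit_event.
  apply: measurableU => //; apply: measurableI => //.
  exact: measurable_bit_event.
by apply/seteqP; split => w; rewrite /Delta_event /= DeltaS.
Qed.

Lemma word_event_sub_Delta n a : (0 < n)%N -> Delta n a ->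
  word_event X 1 n a `<=` Delta_event X n.
Proof. by move=> n0 Da w wa; apply: eq_Delta Da => // i /wa. Qed.

Hypothesis indX : independent_seq X.
Variable s : nat -> R.
Hypothesis Ps : forall i, (1 <= i)%N -> P (X i @^-1` [set false]) = (s i)%:E.

Lemma word_eventE l m a : (1 <= l)%N ->
  P (word_event X l m a) = (\prod_(l <= i < m.+1) bit_law (s i) (a i))%:E.
Proof.
move=> l1; rewrite (_ : word_event _ _ _ _ =
    [set w | forall i, i \in index_iota l m.+1 -> [set a i] (X i w)]).
  rewrite (indX _ (fun i => [set a i])) ?iota_uniq//.
    rewrite -prodEFin big_nat [RHS]big_nat; apply: eq_bigr => i /andP[li _].
    by apply: bit_lawE; apply: Ps; exact: leq_trans li.
  by apply/allP => i; rewrite mem_index_iota => /andP[+ _]; exact: leq_trans.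
apply/seteqP; split => w /= wa i.
  by rewrite mem_index_iota ltnS; exact: wa.
by move=> ilm; apply: wa; rewrite mem_index_iota ltnS.
Qed.

(* Two-step recursion: a word of [Delta n.+3] ends in [0] preceded either by a
   word of [Delta n.+2] or by [1] and a word of [Delta n.+1]. *)
Variable D : nat -> R.
Hypothesis s1 : s 1%N = 0.
Hypothesis D1 : D 1%N = 0.
Hypothesis D2 : D 2%N = s 2%N.
Hypothesis DS : forall n,
  D n.+3 = s n.+3 * (D n.+2 + (1 - s n.+2) * D n.+1).

(** The fixed word above [n] stands in for independence of [Delta_event] from the later bits: at
    each step top entries join this word, until at level 2 a single word is left for
    [word_eventE]. *)
Lemma Delta_word_eventE n m a : (0 < n <= m)%N ->
  P (Delta_event X n `&` word_event X n.+1 m a) =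
  (D n * \prod_(n.+1 <= i < m.+1) bit_law (s i) (a i))%:E.
Proof.
suff H k : (forall m a, (k.+1 <= m)%N ->
    P (Delta_event X k.+1 `&` word_event X k.+2 m a) =
    (D k.+1 * \prod_(k.+2 <= i < m.+1) bit_law (s i) (a i))%:E) /\
  (forall m a, (k.+2 <= m)%N ->
    P (Delta_event X k.+2 `&` word_event X k.+3 m a) =
    (D k.+2 * \prod_(k.+3 <= i < m.+1) bit_law (s i) (a i))%:E).
  by case: n => // n /andP[_]; apply (H n).1.
elim: k {n m a} => [|n [IH1 IH2]]; split => // m a nm.
- rewrite D1 mul0r (_ : Delta_event X 1 = set0) ?set0I ?measure0//.
  by rewrite -subset0 => w /Delta1.
(* [Delta 2] fixes both of its entries, which therefore join the tail; bit 1 contributes the factor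
   [1 - s 1 = 1]. *)
- pose b i := if i == 1%N then true else if i == 2%N then false else a i.
  rewrite (_ : _ `&` _ = word_event X 1 m b); last first.
    apply/seteqP; split => w.
      rewrite /Delta_event /= Delta2 => -[[w1 w2] wa] i im.
      rewrite /b; case: eqP => [->//|i1]; case: eqP => [->//|i2].
      by apply: wa; lia.
    move=> wb; split; first by apply/Delta2; split; rewrite wb//; lia.
    by move=> i im; rewrite wb ?/b; [do 2 (rewrite ifF; last lia)|lia].
  rewrite word_eventE// big_ltn; last lia.
  rewrite big_ltn; last lia.
  rewrite /b /= s1 subr0 mul1r D2; congr ((_ * _)%:E).
  by apply: eq_big_nat => i im; do 2 (rewrite ifF; last lia).
(* [b] adds to the tail the final zero, [c] the final pair 1, 0 of the second case of [DeltaS]. *)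
- pose b i := if i == n.+3 then false else a i.
  pose c i := if i == n.+2 then true else b i.
  rewrite (_ : _ `&` _ =
      (Delta_event X n.+2 `&` word_event X n.+3 m b) `|`
      (Delta_event X n.+1 `&` word_event X n.+2 m c)); last first.
    apply/seteqP; split => w.
      rewrite /Delta_event /= DeltaS => -[[w3 [w2|[w2 w1]]] wa]; [left|right].
        split => // i im; rewrite /b; case: eqP => [->//|i3].
        by apply: wa; lia.
      split => // i im; rewrite /c /b; case: eqP => [->//|i2].
      by case: eqP => [->//|i3]; apply: wa; lia.
    rewrite /Delta_event => -[[w2 wb]|[w1 wc]]; split.
    - apply/DeltaS; split; last by left.
      by rewrite wb ?/b ?eqxx//; lia.
    - by move=> i im; rewrite wb /b; [rewrite ifF//; lia|lia].
    - apply/DeltaS; split; last right; last split=> //.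
        by rewrite wc ?/c ?/b ?eqxx; [rewrite ifF//; lia|lia].
      by rewrite wc ?/c ?eqxx//; lia.
    - by move=> i im; rewrite wc /c /b; [do 2 (rewrite ifF; last lia)|lia].
  rewrite measureU.
  + have E1 : \prod_(n.+4 <= i < m.+1) bit_law (s i) (b i) =
              \prod_(n.+4 <= i < m.+1) bit_law (s i) (a i).
      by apply: eq_big_nat => i im; rewrite /b ifF//; lia.
    have E2 : \prod_(n.+4 <= i < m.+1) bit_law (s i) (c i) =
              \prod_(n.+4 <= i < m.+1) bit_law (s i) (a i).
      by rewrite -E1; apply: eq_big_nat => i im; rewrite /c ifF//; lia.
    have -> : D n.+3 * \prod_(n.+4 <= i < m.+1) bit_law (s i) (a i) =
        D n.+2 * \prod_(n.+3 <= i < m.+1) bit_law (s i) (b i) +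
        D n.+1 * \prod_(n.+2 <= i < m.+1) bit_law (s i) (c i).
      rewrite [X in _ = _ + _ * X]big_ltn; last lia.
      rewrite [X in _ = _ + _ * (_ * X)]big_ltn; last lia.
      rewrite [X in _ = _ * X + _]big_ltn; last lia.
      rewrite E1 E2 DS /c /b !eqxx (_ : (n.+3 == n.+2) = false); last lia.
      by rewrite /=; ring.
    by rewrite EFinD -IH2 -?IH1//; lia.
  + apply: measurableI; last exact: measurable_word_event.
    exact: measurable_Delta_event.
  + apply: measurableI; last exact: measurable_word_event.
    exact: measurable_Delta_event.
  + apply/seteqP; split => // w [[/DeltaP[_ w2 _] _] [_ wc]].
    suff: false = true by [].
    by have := wc n.+2; rewrite w2 /c eqxx; apply; lia.
Qed.

Lemma Delta_eventE n : (0 < n)%N -> P (Delta_event X n) = (D n)%:E.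
Proof.
move=> n0; have := Delta_word_eventE n n (fun=> true).
rewrite n0 leqnn => /(_ isT); rewrite big_geq// mulr1 => <-; congr (P _).
by rewrite setIidl// => w _ i; lia.
Qed.

End IndependentBits.

(** * The law of the playground chain *)

Section PlaygroundChain.
Context {R : realType}.
Variable theta : R.
Hypothesis theta_gt0 : 0 < theta.

Local Notation p := (play_p theta).
Local Notation q := (play_q theta).

Lemma play_pE i : (3 <= i)%N -> p i = (i.-1)%:R / ((i.-1)%:R + theta).
Proof. by case: i => [|[|[|i]]]. Qed.

Lemma play_p_gt0 i : (2 <= i)%N -> 0 < p i.
Proof.
case: i => [|[|[|i]]] // _; rewrite play_pE//.
by rewrite divr_gt0 ?ltr0n// addr_gt0// ltr0n.
Qed.

Lemma play_q_gt0 i : (1 <= i)%N -> i != 2%N -> 0 < q i.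
Proof.
case: i => [|[|[|i]]] // _ _; rewrite /play_q; first by rewrite /play_p subr0.
by rewrite play_pE// subr_gt0 ltr_pdivrMr ?mul1r ?ltrDl// addr_gt0// ltr0n.
Qed.

Lemma prod_play_p_gt0 n : 0 < \prod_(2 <= r < n) p r.
Proof. by rewrite big_nat; apply: prodr_gt0 => i /andP[/play_p_gt0]. Qed.

(** Weight of the step from [x] at index [r.+1] to [y] at index [r]. After a one it is 1 whatever
    [y] is, since in a word of [Delta] only a zero can follow. *)
Definition kappa (r : nat) (x y : bool) : R :=
  if x then 1 else if y then q r else p r.

(** The only vanishing weights are [p 1], excluded by [a 1 = 1], and [q 2], excluded by [a 2 = 0],
    which follows from it. *)
Lemma kappa_gt0 n a r : Delta n a -> (1 <= r < n)%N ->
  0 < kappa r (a r.+1) (a r).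
Proof.
move=> /DeltaP[a1 an an1] rn; rewrite /kappa.
case: ifPn => // ar1; case: ifPn => ar.
  apply: play_q_gt0; first by case/andP: rn.
  apply: contraTneq ar => r2; have := an1 1%N.
  by rewrite a1 r2 => -> //; lia.
apply: play_p_gt0; suff : r != 1%N by lia.
by apply: contraNneq ar => ->; rewrite a1.
Qed.

Section Chain.
Context {d : measure_display} {T : measurableType d} (P : probability T R).
Variables (n : nat) (eta : nat -> {RV P >-> bool}).
Hypotheses (n2 : (2 <= n)%N) (etaP : playground_chain theta n eta).

Lemma playground_word_event a : Delta n a ->
  P (word_event eta 1 n a) =
  (\prod_(1 <= r < n) kappa r (a r.+1) (a r))%:E.
Proof.
move=> Da; have [eta_n1 [eta_n eta_1] markov tr0 tr1] := etaP.
have meta i B : measurable (eta i @^-1` B) by exact: measurable_bit_event.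
have PI A B : measurable A -> measurable B -> P B = 1%E -> P (B `&` A) = P A.
  move=> mA mB PB.
  have PBc : P (~` B) = 0%E.
    by rewrite probability_setC// PB subee.
  have PAB : P (A `\` B) = 0%E.
    apply: (subset_measure0 _ _ _ PBc); last by move=> w [].
    - exact: measurableD.
    - exact: measurableC.
  have -> : P A = (P (A `\` B) + P (A `&` B))%E by exact: measureDI.
  by rewrite PAB add0e setIC.
(* The conditioning words of the chain begin at index [n.+1], where [eta] is almost surely 1; [b]
   adds this entry to [a]. *)
pose b i := if i == n.+1 then true else a i.
have wordS r : word_event eta r n.+1 b =
    (if (r <= n.+1)%N then eta r @^-1` [set b r] else setT) `&`
    word_event eta r.+1 n.+1 b.
  apply/seteqP; split => w.
    move=> wb; split; last by move=> i ri; apply: wb; lia.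
    by case: ifPn => // rn; apply: wb; lia.
  move=> [wr wb] i ri; have [->|ir] := eqVneq i r; last by apply: wb; lia.
  by move: wr; rewrite ifT//; lia.
have /DeltaP[a1 an an1] := Da.
(* [k] counts the transitions made so far; at [k = 0] both entries [n.+1] and [n] are almost
   sure. *)
suff H k : (k < n)%N -> P (word_event eta (n - k) n.+1 b) =
    (\prod_(n - k <= r < n) kappa r (a r.+1) (a r))%:E.
  have := H n.-1; rewrite (_ : (n - n.-1 = 1)%N); last lia.
  move=> <-; last lia.
  rewrite -(PI (word_event eta 1 n a) (eta n.+1 @^-1` [set true]))//; last first.
    exact: measurable_word_event.
  congr (P _); apply/seteqP; split => w.
    move=> [wn wa] i i1n; rewrite /b; case: eqP => [->//|ni]; apply: wa; lia.
  move=> wb; split; first by rewrite /= wb ?/b ?eqxx//; lia.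
  by move=> i i1n; rewrite wb ?/b; [rewrite ifF//|]; lia.
elim: k => [_|k IH kn].
  rewrite subn0 big_geq// wordS leqnSn PI//; last 2 first.
    exact: measurable_word_event.
    by rewrite /b ifF ?an//; lia.
  rewrite -[LHS]/(P _) wordS leqnn PI//; last 2 first.
    exact: measurable_word_event.
    by rewrite /b eqxx.
  rewrite (_ : word_event _ _ _ _ = setT) ?probability_setT//.
  by apply/seteqP; split => // w _ i; lia.
set r := (n - k.+1)%N; have rE : (n - k)%N = r.+1 by lia.
have rn : (1 <= r < n)%N by lia.
rewrite wordS ifT; last lia.
rewrite big_ltn; last lia.
have br : b r = a r by rewrite /b ifF//; lia.
have br1 : b r.+1 = a r.+1 by rewrite /b ifF//; lia.
have {}IH := IH (ltnW kn); rewrite rE in IH.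
(* The Markov property is imposed on non-null words only; positivity of [kappa] along [Delta] gives
   access to it. *)
have pos : P (word_event eta r.+1 n.+1 b) != 0%E.
  rewrite IH eqe gt_eqF// big_nat; apply: prodr_gt0 => i ri.
  by apply: (kappa_gt0 n) => //; lia.
(* No transition is prescribed at index 1: there the bit is almost surely 1, and [kappa] equals 1
   because [q 1 = 1]. *)
have [r1|r1] := eqVneq r 1%N.
  rewrite r1 PI; [|exact: measurable_word_event|exact: meta|].
    rewrite -r1 IH r1 /kappa a1; case: (a 2%N); first by rewrite mul1r.
    by rewrite /play_q /play_p/= subr0 mul1r.
  by rewrite -r1 br r1 a1.
have etar1 : P (eta r.+1 @^-1` [set a r.+1]) != 0%E.
  apply: contra pos => /eqP H; apply/eqP.
  apply: (subset_measure0 _ _ _ H) => //; first exact: measurable_word_event.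
  by move=> w wb; rewrite /= -br1; apply: wb; lia.
have condE : cond_prob P (eta r @^-1` [set a r])
    (eta r.+1 @^-1` [set a r.+1]) = kappa r (a r.+1) (a r).
  have r2n : (2 <= r < n)%N by lia.
  rewrite /kappa; case: ifPn => ar1.
    have -> : a r = false by have := an1 r rn; rewrite ar1 andbT => /negbTE.
    by rewrite ar1 in etar1; exact: tr1.
  rewrite (negbTE ar1) in etar1 *.
  have [p0 q0] := tr0 r r2n etar1.
  by case: (a r).
have := markov r b; rewrite br br1 condE => /(_ _ pos) <-; last lia.
rewrite EFinM -IH /cond_prob.
have fin A : measurable A -> P A \is a fin_num by exact: fin_num_measure.
rewrite -[in LHS](fineK (fin _ _)); last first.
  by apply: measurableI => //; exact: measurable_word_event.
rewrite -[X in _ = (_ * X)%E]fineK ?fin//; last exact: measurable_word_event.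
rewrite -EFinM divfK// -eqe fineK// fin//; exact: measurable_word_event.
Qed.

End Chain.
End PlaygroundChain.

(** * Odds of the independent bits and their normalising constant *)

Section PlaygroundWeights.
Context {R : realType}.
Variables (theta theta1 theta2 : R).
Hypotheses (theta_gt0 : 0 < theta).
Hypotheses (theta1_gt0 : 0 < theta1) (theta2_gt0 : 0 < theta2).

Local Notation t := (theta_star theta theta1 theta2).
Local Notation p := (play_p theta).
Local Notation q := (play_q theta).

Definition prob0 (i : nat) : R := (i.-1)%:R / ((i.-1)%:R + t i).

Lemma theta_star_gt0 i : 0 < t i.
Proof.
rewrite /theta_star; case: ifPn => // _; case: ifPn => // _; case: ifPn => // _.
by rewrite mulr_gt0// ltr_wpDl// divr_ge0 ?ler0n// ltW.
Qed.

Lemma prob0_1 : prob0 1 = 0.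
Proof. by rewrite /prob0 mul0r. Qed.

Lemma prob0_bound i : 0 <= prob0 i < 1.
Proof.
have t0 := theta_star_gt0 i; have i0 : 0 <= (i.-1)%:R :> R by exact: ler0n.
rewrite /prob0 divr_ge0//=; last by rewrite addr_ge0// ltW.
by rewrite ltr_pdivrMr ?mul1r ?ltrDl// ltr_wpDl.
Qed.

Lemma prob0_gt0 i : (2 <= i)%N -> 0 < prob0 i.
Proof.
move=> i2; have t0 := theta_star_gt0 i.
have i0 : 0 < (i.-1)%:R :> R by rewrite ltr0n; lia.
by rewrite /prob0 divr_gt0// addr_gt0.
Qed.

(* This identity determines the odds of [xi_i]: a word of [eta^n] gains the
   factor [q_i] and loses [p_i] and [p_(i-1)] when its entry of index [i] is
   turned from 0 to 1. *)
Lemma prob0_odds i : (3 <= i)%N -> (1 - prob0 i) * (p i * p i.-1) = prob0 i * q i.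
Proof.
case: i => [|[|[|[|i]]]] // _.
  rewrite /play_q /prob0 /play_p /theta_star /=; field.
  by rewrite gt_eqF// addr_gt0.
rewrite /play_q !play_pE// /prob0 /theta_star /=.
have -> : i.+3%:R = i%:R + 3 :> R by rewrite -natrD addn3.
have -> : i.+2%:R = i%:R + 2 :> R by rewrite -natrD addn2.
move: (i%:R) (ler0n R i) => x i0.
have t2 : 0 < x + 2 by lra.
have t3 : 0 < x + 3 by lra.
have t4 : 0 < theta * (theta + (x + 2)) by rewrite mulr_gt0// addr_gt0.
have t6 : 0 < (x + 3) * (x + 2) by exact: mulr_gt0.
by field; apply/and4P; split; rewrite gt_eqF// addr_gt0.
Qed.

(** For [n >= 2], the ratio of the weights of the word 0...01 under the independent bits and under
    the chain; index 1 contributes 1 to both. *)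
Definition Delta_prob (n : nat) : R :=
  if (n <= 1)%N then 0
  else \prod_(2 <= i < n.+1) prob0 i / \prod_(2 <= r < n) p r.

Lemma Delta_prob1 : Delta_prob 1 = 0. Proof. by []. Qed.

Lemma Delta_prob2 : Delta_prob 2 = prob0 2.
Proof. by rewrite /Delta_prob/= big_nat1 big_geq// divr1. Qed.

Lemma Delta_prob_gt0 n : (2 <= n)%N -> 0 < Delta_prob n.
Proof.
case: n => [|[|n]] // _; rewrite /Delta_prob/= divr_gt0 ?prod_play_p_gt0//.
by rewrite big_nat; apply: prodr_gt0 => i /andP[/prob0_gt0].
Qed.

Lemma Delta_probS n : (2 <= n)%N ->
  Delta_prob n.+1 = Delta_prob n * (prob0 n.+1 / p n).
Proof.
case: n => [|[|n]] // _; rewrite /Delta_prob/= big_nat_recr//=.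
rewrite [in X in _ / X]big_nat_recr//=; field.
by rewrite !gt_eqF ?play_p_gt0 ?prod_play_p_gt0.
Qed.

(** By [prob0_odds] the bracket is [Delta_prob n.+2 * (1 + q / p)] at index [n.+2], and [p + q = 1]
    turns it into the division by [p] of [Delta_probS]. For [n = 0] the second term vanishes and
    [p 2 = 1]. *)
Lemma Delta_prob_rec n : Delta_prob n.+3 =
  prob0 n.+3 * (Delta_prob n.+2 + (1 - prob0 n.+2) * Delta_prob n.+1).
Proof.
rewrite Delta_probS//; case: n => [|n].
  by rewrite Delta_prob1 mulr0 addr0 /play_p/= divr1 mulrC.
rewrite [Delta_prob n.+3]Delta_probS//.
have odds := prob0_odds n.+3 isT; rewrite /play_q /= in odds.
have p3 := play_p_gt0 theta theta_gt0 n.+3 isT.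
have p2 := play_p_gt0 theta theta_gt0 n.+2 isT.
have -> : 1 - prob0 n.+3 = prob0 n.+3 * (1 - p n.+3) / (p n.+3 * p n.+2).
  by rewrite -odds mulfK// gt_eqF// mulr_gt0.
by field; rewrite !gt_eqF.
Qed.

(** The ratio of the two weights is the same for all words: by [prob0_odds], a further pair 1, 0
    changes it exactly as two further zeros do. *)
Lemma prod_bit_law n a : (0 < n)%N -> Delta n a ->
  \prod_(1 <= i < n.+1) bit_law (prob0 i) (a i) =
  Delta_prob n * \prod_(1 <= r < n) kappa theta r (a r.+1) (a r).
Proof.
suff H k : (forall a, Delta k.+1 a ->
    \prod_(1 <= i < k.+2) bit_law (prob0 i) (a i) =
    Delta_prob k.+1 * \prod_(1 <= r < k.+1) kappa theta r (a r.+1) (a r)) /\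
  (forall a, Delta k.+2 a ->
    \prod_(1 <= i < k.+3) bit_law (prob0 i) (a i) =
    Delta_prob k.+2 * \prod_(1 <= r < k.+2) kappa theta r (a r.+1) (a r)).
  by case: n => // n _; exact: (H n).1.
elim: k {n a} => [|n [IH1 IH2]]; split => // a.
- by move=> /Delta1.
- move=> /Delta2[a1 a2]; rewrite big_nat1 big_nat_recr//= big_nat1 a1 a2.
  by rewrite /kappa /play_q /play_p/= prob0_1 Delta_prob2 !subr0 mul1r mulr1.
- move=> /DeltaS[a3 [Da|[a2 Da]]].
    rewrite big_nat_recr//= IH2// [in RHS]big_nat_recr//= a3 (Delta_probS n.+2)//.
    have /DeltaP[_ -> _] := Da.
    have := play_p_gt0 theta theta_gt0 n.+2 isT; rewrite /kappa/= => p0.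
    by field; rewrite gt_eqF.
  (* As [Delta 1] is empty, the inserted one has index at least 3, where [prob0_odds] applies. *)
  case: n {IH2} IH1 a3 a2 Da => [|n] IH1 a3 a2 Da; first by case: (Delta1 _ Da).
  rewrite big_nat_recr//= big_nat_recr//= IH1//.
  rewrite [in RHS]big_nat_recr//= [in RHS]big_nat_recr//= a3 a2.
  rewrite (Delta_probS n.+3)// (Delta_probS n.+2)// /kappa/=.
  have odds := prob0_odds n.+3 isT; rewrite /= in odds.
  have p3 := play_p_gt0 theta theta_gt0 n.+3 isT.
have p2 := play_p_gt0 theta theta_gt0 n.+2 isT.
  have -> : 1 - prob0 n.+3 = prob0 n.+3 * q n.+3 / (p n.+3 * p n.+2).
    by rewrite -odds mulfK// gt_eqF// mulr_gt0.
  by field; rewrite !gt_eqF.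
Qed.

End PlaygroundWeights.

(** * Representation and uniqueness *)

(** Dynkin's argument: the laws agree on cylinders, which are stable under intersection and
    generate, and the sets on which they agree form a Dynkin system. *)
Lemma same_law_independent (R : realType)
  (d1 d2 : measure_display) (T1 : measurableType d1) (T2 : measurableType d2)
  (P1 : probability T1 R) (P2 : probability T2 R)
  (X1 : nat -> {RV P1 >-> bool}) (X2 : nat -> {RV P2 >-> bool}) :
  independent_seq X1 -> independent_seq X2 ->
  (forall i, (1 <= i)%N ->
    P1 (X1 i @^-1` [set false]) = P2 (X2 i @^-1` [set false])) ->
  same_law X1 X2.
Proof.
move=> ind1 ind2 P12.
pose pre1 (A : set (nat -> bool)) := [set w | A (fun i => X1 i w)].
pose pre2 (A : set (nat -> bool)) := [set w | A (fun i => X2 i w)].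
(* Measurability of both preimages is part of [H], since the formulas for complements and disjoint
   unions require it. *)
pose H := [set A | [/\ measurable (pre1 A), measurable (pre2 A) &
                       P1 (pre1 A) = P2 (pre2 A)]].
pose cyl m (B : nat -> set bool) := [set x : nat -> bool |
  forall i, (1 <= i <= m)%N -> B i (x i)].
pose G := [set A | exists m B, A = cyl m B].
have GI : setI_closed G.
  move=> _ _ [m [B ->]] [m' [B' ->]]; exists (maxn m m').
  exists (fun i => (if (i <= m)%N then B i else setT) `&`
                   (if (i <= m')%N then B' i else setT)).
  apply/seteqP; split => x.
    move=> [xB xB'] i im; split; case: ifPn => // im'; [apply: xB|apply: xB']; lia.
  move=> xBB'; split => i im.
    by have [|+ _] := xBB' i _; [lia|rewrite ifT//; lia].
  by have [|_] := xBB' i _; [lia|rewrite ifT//; lia].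
have P12b i B : (1 <= i)%N -> P1 (X1 i @^-1` B) = P2 (X2 i @^-1` B).
  move=> i1.
  have E b : P1 (X1 i @^-1` [set b]) = P2 (X2 i @^-1` [set b]).
    have fin : P1 (X1 i @^-1` [set false]) \is a fin_num.
      by apply: fin_num_measure; exact: measurable_bit_event.
    rewrite (bit_lawE P1 X1 (fine (P1 (X1 i @^-1` [set false]))) i b) ?fineK//.
    by rewrite (bit_lawE P2 X2 (fine (P1 (X1 i @^-1` [set false]))) i b) ?fineK// P12.
  have [Bt|Bt] := pselect (B true); have [Bf|Bf] := pselect (B false).
  - have -> : B = setT by apply/seteqP; split => // -[].
    by rewrite !preimage_setT !probability_setT.
  - have -> : B = [set true] by apply/seteqP; split => // -[]//.
    exact: E.
  - have -> : B = [set false] by apply/seteqP; split => // -[]//.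
    exact: E.
  - have -> : B = set0 by apply/seteqP; split => // -[]//.
    by rewrite !preimage_set0 !measure0.
have mcyl d (T : measurableType d) (P : probability T R)
    (X : nat -> {RV P >-> bool}) m B :
    measurable [set w | cyl m B (fun i => X i w)].
  rewrite (_ : [set w | _] =
      \bigcap_(i in [set i | (1 <= i <= m)%N]) (X i @^-1` B i)) //.
  by apply: bigcap_measurableType => i _; exact: measurable_bit_event.
have Pcyl d (T : measurableType d) (P : probability T R)
    (X : nat -> {RV P >-> bool}) m B :
    independent_seq X -> P [set w | cyl m B (fun i => X i w)] =
    (\prod_(1 <= i < m.+1) P (X i @^-1` B i))%E.
  move=> ind; rewrite -ind ?iota_uniq//; last first.
    by apply/allP => i; rewrite mem_index_iota => /andP[].
  congr (P _); apply/seteqP; split => w /= wB i.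
    by rewrite mem_index_iota ltnS; exact: wB.
  by move=> im; apply: wB; rewrite mem_index_iota ltnS.
have GH : G `<=` H.
  move=> _ [m [B ->]]; split; [exact: mcyl|exact: mcyl|].
  rewrite [LHS]Pcyl// [RHS]Pcyl//.
  by apply: eq_big_nat => i /andP[i1 _]; exact: P12b.
have dH : dynkin H.
  split.
  - split; rewrite /pre1 /pre2 /=; [exact: measurableT|exact: measurableT|].
    by rewrite [LHS]probability_setT [RHS]probability_setT.
  - move=> A [m1 m2 A12]; split; [exact: measurableC|exact: measurableC|].
    by rewrite [LHS]probability_setC// [RHS]probability_setC// A12.
  - move=> F tF HF.
    have p1 : pre1 (\bigcup_k F k) = \bigcup_k pre1 (F k) by [].
    have p2 : pre2 (\bigcup_k F k) = \bigcup_k pre2 (F k) by [].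
    have m1 k : measurable (pre1 (F k)) by have [] := HF k.
    have m2 k : measurable (pre2 (F k)) by have [] := HF k.
    split; rewrite ?p1 ?p2; [exact: bigcup_measurable|exact: bigcup_measurable|].
    rewrite [LHS]measure_semi_bigcup//; last 2 first.
    + apply/trivIsetP => i j _ _ ij; apply/seteqP; split => // w [wi wj].
      have /trivIsetP /(_ i j I I ij)/seteqP[+ _] := tF; apply.
      by split; [exact: wi|exact: wj].
    + exact: bigcup_measurable.
    rewrite [RHS]measure_semi_bigcup//; last 2 first.
    + apply/trivIsetP => i j _ _ ij; apply/seteqP; split => // w [wi wj].
      have /trivIsetP /(_ i j I I ij)/seteqP[+ _] := tF; apply.
      by split; [exact: wi|exact: wj].
    + exact: bigcup_measurable.
    by apply: eq_eseriesr => k _; have [] := HF k.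
move=> A mA; suff [] : H A by [].
(* Sets fixing one coordinate are cylinders, and for an intersection-stable family the generated
   Dynkin system is the sigma-algebra. *)
have : <<d G >> A.
  rewrite setI_closed_g_dynkin_g_sigma_algebra//; move: A mA.
  apply: smallest_sub; first exact: smallest_sigma_algebra.
  move=> _ [i [b [i1 ->]]]; apply: sub_gen_smallest.
  exists i, (fun j => if j == i then [set b] else setT).
  apply/seteqP; split => x /=.
    by move=> xi j _; case: eqP => [->|].
  by move=> /(_ i); rewrite i1 leqnn eqxx; exact.
by apply: smallest_sub.
Qed.

(** * Conditioned bits and the chain, in both directions *)

Section Representation.
Context {R : realType}.
Variables (theta theta1 theta2 : R).
Hypotheses (theta_gt0 : 0 < theta).
Hypotheses (theta1_gt0 : 0 < theta1) (theta2_gt0 : 0 < theta2).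
Variables (dQ : nat -> measure_display) (TQ : forall n, measurableType (dQ n)).
Variables (Q : forall n, probability (TQ n) R).
Variable (eta : forall n : nat, nat -> {RV (Q n) >-> bool}).
Hypothesis (etaP : forall n : nat, (2 <= n)%N -> playground_chain theta n (eta n)).

Local Notation s := (prob0 theta theta1 theta2).
Local Notation D := (Delta_prob theta theta1 theta2).

Section Law.
Context {d : measure_display} {T : measurableType d}.
Variables (P : probability T R) (X : nat -> {RV P >-> bool}).
Hypothesis indX : independent_seq X.

Lemma Delta_event_prob n : (0 < n)%N ->
  (forall i, (1 <= i)%N -> P (X i @^-1` [set false]) = (s i)%:E) ->
  P (Delta_event X n) = (D n)%:E.
Proof.
move=> n0 Ps; apply: (Delta_eventE P X indX s Ps D) => //.
- exact: prob0_1.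
- exact: Delta_prob2.
- by move=> k; exact: Delta_prob_rec.
Qed.

Lemma prob_playground n a : (2 <= n)%N -> Delta n a ->
  fine (Q n (word_event (eta n) 1 n a)) =
  \prod_(1 <= i < n.+1) bit_law (s i) (a i) / D n.
Proof.
move=> n2 Da.
rewrite (playground_word_event theta theta_gt0 (Q n) n (eta n) n2 (etaP n n2))//=.
rewrite (prod_bit_law theta theta1 theta2)//; last exact: ltnW.
by rewrite mulrAC mulfV ?mul1r// gt_eqF// Delta_prob_gt0.
Qed.

Lemma represents_bernoulli :
  (forall i, (1 <= i)%N -> P (X i @^-1` [set false]) = (s i)%:E) ->
  represents X eta.
Proof.
move=> Ps n n4; have n0 : (0 < n)%N by lia.
rewrite Delta_event_prob//; split.
  by rewrite eqe gt_eqF// Delta_prob_gt0//; lia.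
move=> a Da; rewrite prob_playground//; last lia.
rewrite /cond_prob Delta_event_prob// setIidl; last exact: word_event_sub_Delta.
by rewrite (word_eventE P X indX s Ps).
Qed.

(** The words of [Delta n] considered here all have entries 1 and 0 at indices 1 and 2, so those two
    laws must be given. For [i >= 3], the odds are read off from the word whose only one is at index
    1 and the word with a further one at [i]. *)
Lemma bernoulli_of_represents : represents X eta ->
  P (X 1%N @^-1` [set false]) = (s 1%N)%:E ->
  P (X 2%N @^-1` [set false]) = (s 2%N)%:E ->
  forall i, (1 <= i)%N -> P (X i @^-1` [set false]) = (s i)%:E.
Proof.
move=> repX P1 P2 i i1.
have [->//|i_n1] := eqVneq i 1%N; have [->//|i_n2] := eqVneq i 2%N.
pose s' j := fine (P (X j @^-1` [set false])).
have Ps' j : P (X j @^-1` [set false]) = (s' j)%:E.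
  by rewrite fineK// fin_num_measure//; exact: measurable_bit_event.
(* The top entry of a word is zero, so [i.+1] is the lowest level at which bit [i] can be 1; it is
   at least 4. *)
have [D0 repi] := repX i.+1 (ltac:(lia)).
set c := fine (P (Delta_event X i.+1)) in repi *.
have c0 : c != 0.
  by rewrite fine_eq0// fin_num_measure//; exact: measurable_Delta_event.
have Di0 : D i.+1 != 0 by rewrite gt_eqF// Delta_prob_gt0//; lia.
have word a : Delta i.+1 a -> \prod_(1 <= j < i.+2) bit_law (s' j) (a j) =
    c / D i.+1 * \prod_(1 <= j < i.+2) bit_law (s j) (a j).
  move=> Da; have := repi a Da.
  rewrite prob_playground//.
  rewrite /cond_prob setIidl; last exact: word_event_sub_Delta.
  rewrite (word_eventE P X indX s') //= -/c => /(congr1 ( *%R^~ c)).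
  by rewrite divfK// => <-; rewrite mulrC mulrA mulrAC.
(* Weight of the bits other than [i], common to both words. *)
pose A (s : nat -> R) :=
  \prod_(j <- index_iota 1 i.+2 | j != i) bit_law (s j) (j == 1%N).
pose a b j := (j == 1%N) || ((j == i) && b).
have aE (r : nat -> R) b :
    \prod_(1 <= j < i.+2) bit_law (r j) (a b j) = bit_law (r i) b * A r.
  rewrite (bigD1_seq i) ?iota_uniq ?mem_index_iota//=; last lia.
  congr (_ * _); first by rewrite /a eqxx (negbTE i_n1).
  by apply: eq_bigr => j /negbTE ji; rewrite /a ji orbF.
have Da b : Delta i.+1 (a b).
  apply/DeltaP; split; rewrite /a//.
    by case: b; lia.
  by move=> j ij; case: b; lia.
have := word _ (Da false); rewrite !aE /= => Ef.
have := word _ (Da true); rewrite !aE /= => Et.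
(* Adding the relations for the two values of bit [i] eliminates its law. *)
have AA : A s' = c / D i.+1 * A s.
  by transitivity (s' i * A s' + (1 - s' i) * A s'); [ring|rewrite Ef Et; ring].
have As : 0 < A s.
  rewrite /A big_seq_cond; apply: prodr_gt0 => j /andP[].
  rewrite mem_index_iota => /andP[j1 _] _; case: eqP => [->|/eqP jn1] /=.
    by rewrite prob0_1 subr0.
  by apply: prob0_gt0 => //; lia.
have kA : c / D i.+1 * A s != 0 by rewrite !mulf_neq0 ?invr_eq0// gt_eqF.
by rewrite Ps'; congr EFin; apply: (mulIf kA); rewrite -{1}AA Ef mulrCA.
Qed.

End Law.
End Representation.

(** * Gauss's formula for the Gamma function *)

Section OscillatingPower.
Context {R : realType}.
Implicit Types (al be phi t c : R).

(* For [phi = 0] and [phi = pi / 2], the real and imaginary parts of the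
   complex power of [t > 0] with exponent [al + i be]. *)
Definition oscpow al be phi t : R := t `^ al * cos (be * ln t - phi).

Lemma oscpow_norm al be phi t : `|oscpow al be phi t| <= t `^ al.
Proof.
rewrite normrM ger0_norm ?powR_ge0// ler_piMr ?powR_ge0//.
by rewrite ler_norml cos_geN1 cos_le1.
Qed.

Lemma oscpow0 al be phi : 0 < al -> oscpow al be phi 0 = 0.
Proof. by move=> al0; rewrite /oscpow powR0 ?mul0r// gt_eqF. Qed.

Lemma oscpowS al be phi t : 0 < al -> 0 <= t ->
  oscpow (al + 1) be phi t = t * oscpow al be phi t.
Proof.
move=> al0 t0; rewrite /oscpow -(mulr_powRB1 t0 (_ : 0 < al + 1)) ?addrK ?mulrA//.
exact: addr_gt0.
Qed.

(** Differentiating the cosine shifts its phase by [pi / 2], so the derivative stays in the same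
    family. *)
Lemma is_derive_oscpow al be phi t : 0 < t ->
  is_derive t 1 (oscpow (al + 1) be phi)
    ((al + 1) * oscpow al be phi t - be * oscpow al be (phi + pi / 2) t).
Proof.
move=> t0.
pose f x := expR ((al + 1) * ln x) * cos (be * ln x - phi).
have fE : \near t, f t = oscpow (al + 1) be phi t.
  near=> x; rewrite /f /oscpow /powR gt_eqF//.
  by near: x; exact: lt_nbhsr.
apply: (near_eq_is_derive fE).
have H := is_derive1_ln t0.
apply: is_derive_eq.
rewrite /oscpow /GRing.scale/= subr0 opprD addrA cosBpihalf.
rewrite /powR gt_eqF// mulrDl mul1r expRD lnK//.
by field; rewrite gt_eqF.
Unshelve. all: by end_near. Qed.

Lemma continuous_oscpow al be phi t : 0 < t -> {for t, continuous (oscpow al be phi)}.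
Proof.
move=> t0; have D := is_derive_oscpow (al - 1) be phi t t0.
rewrite subrK in D.
by apply: differentiable_continuous; apply/derivable1_diffP; case: D.
Qed.

(** The phase need not converge at 0, but the cosine is bounded and the positive power tends to
    0. *)
Lemma oscpow_cvg0 al be phi : 0 < al -> oscpow al be phi @ 0^'+ --> oscpow al be phi 0.
Proof.
move=> al0; rewrite oscpow0//; apply/norm_cvg0P.
apply: (@squeeze_cvgr _ _ _ _ (fun=> 0) (fun t => t `^ al)).
- by near=> t; rewrite normr_ge0 oscpow_norm.
- exact: cvg_cst.
- exact: powR_cvg0.
Unshelve. all: by end_near. Qed.

Lemma within_continuous_oscpow al be phi c : 0 < al -> 0 < c ->
  {within `[0, c], continuous (oscpow al be phi)}.
Proof.
move=> al0 c0; apply/continuous_within_itvP => //; split.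
- by move=> t; rewrite in_itv/= => /andP[t0 _]; exact: continuous_oscpow.
- exact: oscpow_cvg0.
- by apply: cvg_at_left_filter; exact: continuous_oscpow.
Qed.

End OscillatingPower.

(** * Truncated Gamma integrals in closed form *)

Section TruncatedGamma.
Context {R : realType}.
Implicit Types (al be phi t c : R) (m : nat).
Notation mu := (@lebesgue_measure R).

(** Euler's integrand with [expR (- t)] replaced by [(1 - t / c) ^+ m]. The limit takes [c = m],
    while the recursion on [m] needs [c] fixed. *)
Definition trunc_gamma m c al be phi t : R :=
  oscpow al be phi t * (1 - t / c) ^+ m.

Lemma within_continuous_trunc_gamma m c al be phi : 0 < al -> 0 < c ->
  {within `[0, c], continuous (trunc_gamma m c al be phi)}.
Proof.
move=> al0 c0 x; apply: cvgM; first exact: within_continuous_oscpow.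
move: x; apply: continuous_subspaceT => x.
apply: (@continuous_comp _ _ _ (fun t => 1 - t / c) (fun y => y ^+ m)).
  apply: continuousB; first exact: cst_continuous.
  by apply: continuousM; [exact: cvg_id|exact: cst_continuous].
exact: exprn_continuous.

Qed.

Lemma integrable_trunc_gamma m c al be phi : 0 < al -> 0 < c ->
  mu.-integrable `[0, c] (EFin \o trunc_gamma m c al be phi).
Proof.
move=> al0 c0; apply: continuous_compact_integrable; first exact: segment_compact.
exact: within_continuous_trunc_gamma.
Qed.

Definition Rtrunc_gamma m c al be phi : R :=
  \int[mu]_(t in `[0, c]) trunc_gamma m c al be phi t.

Lemma Rtrunc_gammaS m c al be phi : 0 < al -> 0 < c ->
  Rtrunc_gamma m.+1 c al be phi =
  Rtrunc_gamma m c al be phi - c^-1 * Rtrunc_gamma m c (al + 1) be phi.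
Proof.
move=> al0 c0; have al1 : 0 < al + 1 by exact: addr_gt0.
have i0 := integrable_trunc_gamma m c al be phi al0 c0.
have i1 := integrable_trunc_gamma m c (al + 1) be phi al1 c0.
rewrite /Rtrunc_gamma -RintegralZl// -RintegralB//; last exact: (integrableZl _ _ i1).
apply: eq_Rintegral => t; rewrite inE/= in_itv/= => /andP[t0 _].
rewrite /trunc_gamma oscpowS// exprS; ring.
Qed.

Lemma Rtrunc_gamma0 c al be phi : 0 < al -> 0 < c ->
  (al + 1) * Rtrunc_gamma 0 c al be phi -
    be * Rtrunc_gamma 0 c al be (phi + pi / 2) =
  oscpow (al + 1) be phi c.
Proof.
move=> al0 c0; have al1 : 0 < al + 1 by exact: addr_gt0.
have i0 := integrable_trunc_gamma 0 c al be phi al0 c0.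
have i1 := integrable_trunc_gamma 0 c al be (phi + pi / 2) al0 c0.
have i0' : mu.-integrable `[0, c]
    (EFin \o (fun t => (al + 1) * trunc_gamma 0 c al be phi t)).
  exact: (integrableZl _ _ i0).
have i1' : mu.-integrable `[0, c]
    (EFin \o (fun t => be * trunc_gamma 0 c al be (phi + pi / 2) t)).
  exact: (integrableZl _ _ i1).
rewrite /Rtrunc_gamma -RintegralZl// -RintegralZl// -RintegralB//.
rewrite /Rintegral (@continuous_FTC2 _ _ (oscpow (al + 1) be phi))//.
- by rewrite oscpow0// sube0.
- move=> x; apply: cvgB; apply: cvgM; try exact: cvg_cst;
    exact: within_continuous_trunc_gamma.
- split.
  + move=> t; rewrite in_itv/= => /andP[t0 _].
    by have [] := is_derive_oscpow al be phi t t0.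
  + exact: oscpow_cvg0.
  + by apply: cvg_at_left_filter; exact: continuous_oscpow.
- move=> t; rewrite in_itv/= => /andP[t0 _].
  rewrite derive1E; have [_ ->] := is_derive_oscpow al be phi t t0.
  by rewrite /trunc_gamma !expr0 !mulr1.
Qed.

Definition Ctrunc_gamma m c (z : R[i]) : R[i] :=
  Rtrunc_gamma m c (complex.Re z - 1) (complex.Im z) 0 +i*
  Rtrunc_gamma m c (complex.Re z - 1) (complex.Im z) (pi / 2).

Lemma cpowE t (z : R[i]) : 0 < t ->
  cpow t z = oscpow (complex.Re z) (complex.Im z) 0 t +i*
             oscpow (complex.Re z) (complex.Im z) (pi / 2) t.
Proof.
move=> t0; case: z => a b; rewrite /cpow /cexp /oscpow /powR gt_eqF//=.
by rewrite cosBpihalf !mulr0 !subr0 add0r; simpc.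
Qed.

Lemma complexM (a b a' b' : R) :
  (a +i* b) * (a' +i* b') = (a * a' - b * b') +i* (a * b' + b * a').
Proof. by simpc. Qed.

Lemma Ctrunc_gamma0 c (z : R[i]) : 1 < complex.Re z -> 0 < c ->
  z * Ctrunc_gamma 0 c z = cpow c z.
Proof.
case: z => a b /= a1 c0; have a0 : 0 < a - 1 by rewrite subr_gt0.
have := Rtrunc_gamma0 c (a - 1) b (pi / 2) a0 c0.
have := Rtrunc_gamma0 c (a - 1) b 0 a0 c0.
rewrite subrK add0r cpowE//= /Ctrunc_gamma/= => <-.
(* A phase shift by [pi] is a change of sign; the relations at phases 0 and [pi / 2] thus become the
   two components of a complex product. *)
have -> : Rtrunc_gamma 0 c (a - 1) b (pi / 2 + pi / 2) =
    - Rtrunc_gamma 0 c (a - 1) b 0.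
  rewrite -[RHS]mulN1r /Rtrunc_gamma -RintegralZl//; last exact: integrable_trunc_gamma.
  apply: eq_Rintegral => t _; rewrite /trunc_gamma /oscpow -splitr.
  by rewrite cosB cospi sinpi subr0; ring.
by move=> <-; rewrite complexM mulrN opprK.
Qed.

Lemma Ctrunc_gammaS m c (z : R[i]) : 1 < complex.Re z -> 0 < c ->
  Ctrunc_gamma m.+1 c z = Ctrunc_gamma m c z - (c^-1)%:C * Ctrunc_gamma m c (z + 1).
Proof.
case: z => a b /= a1 c0; have a0 : 0 < a - 1 by rewrite subr_gt0.
rewrite /Ctrunc_gamma/= addr0 !Rtrunc_gammaS//.
by rewrite -[a + 1 - 1]addrAC; simpc.
Qed.

Lemma cpowD1 c (z : R[i]) : 0 < c -> cpow c (z + 1) = cpow c z * c%:C.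
Proof.
case: z => a b c0; rewrite !cpowE//= addr0.
have E phi : oscpow (a + 1) b phi c = c * oscpow a b phi c.
  have h : (a + 1 == 0) ==> (c != 0) by rewrite (gt_eqF c0) implybT.
  rewrite /oscpow (powRD h) powRr1 ?ltW//.
  by rewrite mulrAC mulrC.
by rewrite !E; simpc; rewrite ![_ * c]mulrC.
Qed.

Lemma Re_gt0_neq0 (z : R[i]) : 0 < complex.Re z -> z != 0.
Proof. by move=> z0; apply: contraTneq z0 => ->; rewrite ltxx. Qed.

(** Induction for all [z] at once, since the recursion calls [z + 1]. The two denominators share the
    factors z + 1, ..., z + m, and 1/z - 1/(z + m + 1) yields the new factor m + 1 of the
    factorial. *)
Lemma Ctrunc_gammaE m c (z : R[i]) : 1 < complex.Re z -> 0 < c ->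
  Ctrunc_gamma m c z = cpow c z * (m`!)%:R / \prod_(k < m.+1) (z + k%:R).
Proof.
move=> z1 c0; elim: m z z1 => [|m IH] z z1.
  have z0 : z != 0 by apply: Re_gt0_neq0; exact: lt_trans z1.
  by rewrite big_ord1 addr0 mulr1 -Ctrunc_gamma0//; field.
have z1' : 1 < complex.Re (z + 1) by rewrite raddfD/= ltr_wpDr.
rewrite Ctrunc_gammaS// !IH// cpowD1//.
have Re_n k : complex.Re (k%:R : R[i]) = k%:R by rewrite (raddfMn (@complex.Re R)).
have pos k : z + k%:R != 0.
  by apply: Re_gt0_neq0; rewrite raddfD/= Re_n ltr_wpDr// (lt_trans _ z1).
have pos1 k : z + 1 + k%:R != 0 by rewrite -addrA nat1r.
rewrite [in RHS]big_ord_recl [in RHS]big_ord_recr/= addr0.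
rewrite [X in _ / X - _]big_ord_recl/= addr0.
rewrite [X in _ - _ * (_ / X)]big_ord_recr/=.
have E n : \prod_(k < n) (z + (bump 0 k)%:R) = \prod_(k < n) (z + 1 + k%:R).
  by apply: eq_bigr => k _; rewrite /bump /= add1n -nat1r addrA.
rewrite !E.
have Q0 : \prod_(k < m) (z + 1 + k%:R) != 0 by apply/prodf_neq0 => k _; exact: pos1.
have cC : (c^-1)%:C * c%:C = 1 :> R[i] by rewrite -rmorphM/= mulVf// gt_eqF.
rewrite factS natrM.
have -> : (bump 0 m)%:R = 1 + m%:R :> R[i] by rewrite /bump add1n -nat1r.
have z0 : z != 0 by have := pos 0%N; rewrite addr0.
have zm := pos1 m.
rewrite [_ * (cpow c z * c%:C * _ / _)](_ : _ = cpow c z * m`!%:R /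
    (\prod_(k < m) (z + 1 + k%:R) * (z + 1 + m%:R))); last first.
  by rewrite -[RHS]mul1r -cC; ring.
by rewrite addrA; field; rewrite zm Q0 z0.
Qed.

End TruncatedGamma.

(** * Dominated convergence to Euler's integral *)

Section GammaLimit.
Context {R : realType}.
Implicit Types (al be phi t c : R) (m : nat).
Notation mu := (@lebesgue_measure R).

(** Bernoulli's inequality. *)
Lemma ler_1Bexpn (y : R) m : 0 <= y <= 1 -> 1 - m%:R * y <= (1 - y) ^+ m.
Proof.
move=> /andP[y0 y1]; elim: m => [|m IH]; first by rewrite mul0r subr0.
rewrite exprS -nat1r; have m0 : 0 <= m%:R :> R by exact: ler0n.
have := ler_wpM2l (_ : 0 <= 1 - y) IH; rewrite subr_ge0 => /(_ y1).
apply: le_trans; move: (m%:R) m0 => x x0; have := mulr_ge0 x0 (mulr_ge0 y0 y0); nra.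
Qed.

Lemma trunc_expR_le t m : 0 <= t <= m%:R -> (1 - t / m%:R) ^+ m <= expR (- t).
Proof.
case: m => [|m] /andP[t0 tm].
  have -> : t = 0 by apply/eqP; rewrite eq_le t0 tm.
  by rewrite expr0 oppr0 expR0.
have m0 : 0 < m.+1%:R :> R by rewrite ltr0n.
have -> : - t = m.+1%:R * (- (t / m.+1%:R)) by field; rewrite gt_eqF.
rewrite expRM_natl; apply: lerXn2r; rewrite ?nnegrE ?expR_ge0 ?expR_ge1Dx//.
by rewrite subr_ge0 ler_pdivrMr ?mul1r.
Qed.

(** With [x = t / m], Bernoulli's inequality gives 1 - m x^2 <= (1 - x^2)^m = (1 - x)^m (1 + x)^m,
    and the last factor is at most exp t. *)
Lemma trunc_expR_ge t m : 0 <= t <= m%:R ->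
  expR (- t) * (1 - t ^+ 2 / m%:R) <= (1 - t / m%:R) ^+ m.
Proof.
case: m => [|m] /andP[t0 tm].
  have -> : t = 0 by apply/eqP; rewrite eq_le t0 tm.
  by rewrite !expr0 invr0 mulr0 subr0 oppr0 expR0 mulr1.
set n := m.+1 in tm *.
have n0 : 0 < n%:R :> R by rewrite ltr0n.
set x := t / n%:R; have x0 : 0 <= x by rewrite divr_ge0// ltW.
have x1 : x <= 1 by rewrite ler_pdivrMr ?mul1r.
have tE : t = n%:R * x by rewrite /x; field; rewrite gt_eqF.
rewrite expRN mulrC ler_pdivrMr ?expR_gt0//.
rewrite {2}tE expRM_natl -exprMn.
have -> : t ^+ 2 / n%:R = n%:R * x ^+ 2 by rewrite /x; field; rewrite gt_eqF.
apply: le_trans (ler_1Bexpn (x ^+ 2) n _) _.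
  by rewrite sqr_ge0 expr_le1.
apply: lerXn2r; rewrite ?nnegrE.
- by rewrite subr_ge0 expr_le1.
- by rewrite mulr_ge0 ?expR_ge0// subr_ge0.
- have -> : 1 - x ^+ 2 = (1 - x) * (1 + x) by ring.
  by apply: ler_wpM2l; [rewrite subr_ge0|exact: expR_ge1Dx].
Qed.

Lemma trunc_expR_cvg t : 0 <= t ->
  (1 - t / m%:R) ^+ m @[m --> \oo] --> expR (- t).
Proof.
move=> t0.
apply: (@squeeze_cvgr _ _ _ _
  (fun m => expR (- t) * (1 - t ^+ 2 / m%:R)) (fun=> expR (- t))).
- near=> m; have tm : 0 <= t <= m%:R by rewrite t0/=; near: m; exact: nbhs_infty_ger.
  by rewrite trunc_expR_le ?trunc_expR_ge.
- rewrite -[X in _ --> X]mulr1; apply: cvgM; first exact: cvg_cst.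
  rewrite -[X in _ --> X]subr0; apply: cvgB; first exact: cvg_cst.
  rewrite -[X in _ --> X](mulr0 (t ^+ 2)); apply: cvgM; first exact: cvg_cst.
  rewrite -cvg_shiftS/=; exact: cvg_harmonic.
- exact: cvg_cst.
Unshelve. all: by end_near. Qed.

(** The logarithm is below the identity at [t / (2 * al)]; the power thus costs only half of the
    decay of [expR (- t)]. *)
Lemma powR_le_expR al t : 0 < al -> 0 < t ->
  t `^ al <= expR (al * ln (2 * al)) * expR (2^-1 * t).
Proof.
move=> al0 t0; rewrite /powR gt_eqF// -expRD ler_expR.
have al2 : 0 < 2 * al by rewrite mulr_gt0.
have t2 : 0 < t / (2 * al) by rewrite divr_gt0.
have -> : ln t = ln (2 * al) + ln (t / (2 * al)).
  by rewrite -lnM ?posrE//; congr ln; field; rewrite gt_eqF.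
rewrite mulrDr lerD2l.
have -> : 2^-1 * t = al * (t / (2 * al)) by field; rewrite gt_eqF.
by rewrite ler_pM2l//; apply: ltW; exact: ln_sublinear.
Qed.

Lemma measurable_oscpow al be phi : measurable_fun setT (oscpow al be phi).
Proof.
apply: measurable_funM; first exact: measurable_powR.
apply: (@measurableT_comp _ _ _ _ _ _ cos).
  by apply: continuous_measurable_fun; exact: continuous_cos.
by apply: measurable_funB => //; apply: measurable_funM => //; exact: measurable_ln.
Qed.

Lemma measurable_trunc_gamma m c al be phi :
  measurable_fun setT (trunc_gamma m c al be phi).
Proof.
apply: measurable_funM; first exact: measurable_oscpow.
by apply: measurable_funX; apply: measurable_funB => //; exact: measurable_funM.
Qed.

Lemma integrable_expRN2 k :
  mu.-integrable `]0, +oo[ (fun t => (k * expR (- (2^-1 * t)))%:E).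
Proof.
have half : 0 < 2^-1 :> R by [].
have H : mu.-integrable `]0, +oo[ (EFin \o exponential_pdf (2^-1 : R)).
  by apply: integrableS (integrable_exponential_pdf half).
apply: (@eq_integrable _ _ _ mu _ (measurable_itv _)
  (fun t => (k * 2)%:E * (EFin \o exponential_pdf (2^-1 : R)) t)%E) => //.
  move=> t; rewrite inE/= in_itv/= andbT => t0.
  rewrite exponential_pdfE ?ltW// -EFinM; congr EFin.
  by rewrite mulNr; field.
exact: integrableZl.
Qed.

Lemma oscpow_expR_dominated al be phi : 0 < al ->
  mu.-integrable `]0, +oo[ (fun t => (oscpow al be phi t * expR (- t))%:E) /\
  Rtrunc_gamma m m%:R al be phi @[m --> \oo] -->
  \int[mu]_(t in `]0, +oo[) (oscpow al be phi t * expR (- t)).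
Proof.
move=> al0.
(* Extension by zero beyond [m] puts all truncated integrals on the same domain; [g] below combines
   [powR_le_expR] with [trunc_expR_le]. *)
pose f_ m t : \bar R :=
  ((fun t => (trunc_gamma m m%:R al be phi t)%:E) \_ `]0, m%:R]) t.
pose f t := (oscpow al be phi t * expR (- t))%:E.
pose g t := (expR (al * ln (2 * al)) * expR (- (2^-1 * t)))%:E.
have mf_ m : measurable_fun (`]0, +oo[%classic : set R) (f_ m).
  apply: measurable_funTS.
  apply/(measurable_restrictT _ _).1 => //; apply/measurable_EFinP.
  by apply: measurable_funTS; exact: measurable_trunc_gamma.
have mf : measurable_fun (`]0, +oo[%classic : set R) f.
  apply/measurable_EFinP; apply: measurable_funTS; apply: measurable_funM.
    exact: measurable_oscpow.
  by apply: measurableT_comp => //; exact: measurable_funN.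
have f_f : {ae mu, forall t, `]0, +oo[%classic t -> f_ ^~ t @ \oo --> f t}.
  apply: aeW => t /=; rewrite in_itv/= andbT => t0.
  apply: cvg_EFin; first by near=> m; rewrite /f_ patchE; case: ifP.
  have : oscpow al be phi t * (1 - t / m%:R) ^+ m @[m --> \oo] -->
      oscpow al be phi t * expR (- t).
    by apply: cvgM; [exact: cvg_cst|apply: trunc_expR_cvg; exact: ltW].
  apply: cvg_trans; apply: near_eq_cvg; near=> m.
  rewrite /= /f_ patchE ifT//= inE/= in_itv/= t0/=.
  by near: m; exact: nbhs_infty_ger.
have f_g : {ae mu, forall t m, `]0, +oo[%classic t -> (`|f_ m t| <= g t)%E}.
  apply: aeW => t m /=; rewrite in_itv/= andbT => t0.
  rewrite /f_ patchE; case: ifPn; last by rewrite abse0 lee_fin mulr_ge0 ?expR_ge0.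
  rewrite inE/= in_itv/= t0/= => tm; rewrite lee_fin normrM.
  have m0 : 0 < m%:R :> R by exact: lt_le_trans tm.
  have -> : - (2^-1 * t) = 2^-1 * t + - t by lra.
  rewrite expRD mulrA; apply: ler_pM => //.
    by apply: le_trans (oscpow_norm _ _ _ _) _; exact: powR_le_expR.
  rewrite normrX ger0_norm ?subr_ge0 ?ler_pdivrMr ?mul1r//.
  by apply: trunc_expR_le; rewrite ltW.
have [intf _ cvgf] := @dominated_convergence _ _ _ mu _
  (measurable_itv `]0, +oo[) f_ f _ mf_ mf f_f (integrable_expRN2 _) f_g.
split => //; rewrite /Rintegral; apply: fine_cvg.
rewrite fineK; last exact: integrable_fin_num.
move: cvgf; apply: cvg_trans; apply: near_eq_cvg; near=> m.
rewrite /= /f_ -integral_mkcondr.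
have -> : `]0, +oo[%classic `&` `]0, m%:R]%classic = `]0, m%:R]%classic :> set R.
  by apply/seteqP; split => t /=; rewrite !in_itv/= ?andbT; [case|move=> /andP[->]].
rewrite integral_itv_obnd_cbnd//; apply/measurable_EFinP; apply: measurable_funTS.
exact: measurable_trunc_gamma.
Unshelve. all: by end_near. Qed.

Lemma real_complex_cvg {I : Type} {F : set_system I} {FF : Filter F}
    (u : I -> R) (a : R) :
  u @ F --> a -> ((u x)%:C : R[i]^o) @[x --> F] --> (a%:C : R[i]^o).
Proof.
move=> ua; apply/cvgrPdist_lt => -[e e'] ; rewrite ltcE/= => /andP[/eqP -> e0].
have /cvgrPdist_lt/(_ e e0) := ua; apply: filterS => x.
rewrite -rmorphB/= normc_def/= expr0n addr0 sqrtr_sqr.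
by rewrite ltcE/= eqxx.
Qed.

Lemma complex_cvg {I : Type} {F : set_system I} {FF : Filter F}
    (u v : I -> R) (a b : R) :
  u @ F --> a -> v @ F --> b ->
  (u x +i* v x : R[i]^o) @[x --> F] --> (a +i* b : R[i]^o).
Proof.
move=> ua vb.
have E (x y : R) : x +i* y = x%:C + y%:C * 'i%C by simpc.
under eq_fun do rewrite E.
rewrite E; apply: cvgD; first exact: real_complex_cvg.
by apply: cvgM; [exact: real_complex_cvg|exact: cvg_cst].
Qed.

Lemma GammaE (z : R[i]) : Gamma z =
  (\int[mu]_(t in `]0, +oo[)
    (oscpow (complex.Re z - 1) (complex.Im z) 0 t * expR (- t))) +i*
  (\int[mu]_(t in `]0, +oo[)
    (oscpow (complex.Re z - 1) (complex.Im z) (pi / 2) t * expR (- t))).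
Proof.
have GE t : 0 < t -> Gamma_integrand z t =
    (oscpow (complex.Re z - 1) (complex.Im z) 0 t * expR (- t)) +i*
    (oscpow (complex.Re z - 1) (complex.Im z) (pi / 2) t * expR (- t)).
  move=> t0; rewrite /Gamma_integrand cpowE// raddfB/= raddfB/= subr0.
  by simpc.
rewrite /Gamma; congr (_ +i* _); apply: eq_Rintegral => t;
  by rewrite inE => t0; rewrite GE//; move: t0; rewrite /= in_itv/= andbT.
Qed.

Lemma Gamma_cvg (z : R[i]) : 1 < complex.Re z ->
  (cpow m%:R z * (m`!)%:R / \prod_(k < m.+1) (z + k%:R) : R[i]^o) @[m --> \oo]
  --> (Gamma z : R[i]^o).
Proof.
move=> z1; have a0 : 0 < complex.Re z - 1 by rewrite subr_gt0.
rewrite GammaE.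
have [_ cu] := oscpow_expR_dominated _ (complex.Im z) 0 a0.
have [_ cv] := oscpow_expR_dominated _ (complex.Im z) (pi / 2) a0.
apply: cvg_trans (complex_cvg _ _ _ _ cu cv); apply: near_eq_cvg.
(* Index 0 is left out because the truncation point [c = m] must be positive. *)
exists 1%N => // m /= m1.
by rewrite -Ctrunc_gammaE// ltr0n.
Qed.

(** Allows the division by [Gamma (z1 + z2)], whose argument [3 + theta] is real. The integrand is
    nonnegative, and at least [expR (- 2)] on ]1, 2]. *)
Lemma Gamma_real_neq0 (x : R) : 1 < x -> Gamma x%:C != 0.
Proof.
move=> x1; have a0 : 0 < x - 1 by rewrite subr_gt0.
apply: Re_gt0_neq0; rewrite GammaE/=.
have [intf _] := oscpow_expR_dominated _ 0 0 a0.
set f := (fun t => _) in intf *.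
have mf (D : set R) : measurable D -> measurable_fun D f.
  move=> mD; apply/measurable_EFinP; apply: measurable_funTS; apply: measurable_funM.
    exact: measurable_oscpow.
  by apply: measurableT_comp => //; exact: measurable_funN.
have f0 t : (0 <= f t)%E.
  by rewrite lee_fin /oscpow mul0r subr0 cos0 mulr1 mulr_ge0 ?powR_ge0 ?expR_ge0.
apply: (@lt_le_trans _ _ (expR (- 2))); first exact: expR_gt0.
rewrite -lee_fin fineK; last exact: integrable_fin_num.
apply: (@le_trans _ _ (\int[mu]_(t in `]1%R, 2%R]) f t)%E); last first.
  apply: ge0_subset_integral => //; first exact: mf.
  by move=> t /=; rewrite !in_itv/= andbT => /andP[/(lt_trans ltr01)].
apply: (@le_trans _ _ (\int[mu]_(t in `]1%R, 2%R]) (expR (- 2))%:E)%E).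
  rewrite integral_cst//= lebesgue_measure_itv/= lte_fin ltr1n/=.
  rewrite -EFinD -EFinM lee_fin.
  by have -> : 2 - 1 = 1 :> R; [ring|rewrite mulr1].
apply: ge0_le_integral => //=.
- exact: mf.
- move=> t; rewrite in_itv/= => /andP[t1 t2].
  rewrite lee_fin /oscpow mul0r subr0 cos0 mulr1.
  rewrite -[X in X <= _]mul1r; apply: ler_pM => //.
    by have := ler_powR (ltW t1) (ltW a0); rewrite powRr0.
  by rewrite ler_expR lerN2.
Qed.

End GammaLimit.

(** * The limit *)

Section DeltaLimit.
Context {R : realType}.
Variables (theta theta2 : R).
Hypothesis theta_gt0 : 0 < theta.

Lemma cpowD (t : R) (z w : R[i]) : cpow t (z + w) = cpow t z * cpow t w.
Proof.
rewrite /cpow mulrDl; move: (z * _) (w * _) => -[a b] [c d].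
by rewrite /cexp/= expRD cosD sinD; simpc; congr (_ +i* _); ring.
Qed.

Lemma cpow_neq0 (t : R) (z : R[i]) : cpow t z != 0.
Proof.
have : cpow t z * cpow t (- z) != 0.
  rewrite -cpowD subrr /cpow mul0r /cexp/= expR0 cos0 sin0; simpc.
  by rewrite oner_eq0.
by rewrite mulf_eq0 negb_or => /andP[].
Qed.

Lemma z1Dz2 : z1 theta + z2 theta = (3 + theta)%:C.
Proof. by rewrite /z1 /z2; field. Qed.

Lemma z1Mz2 : z1 theta * z2 theta = (theta ^+ 2 + theta + 2)%:C.
Proof.
rewrite /z1 /z2; set w := sqrtc _.
have w2 : w ^+ 2 = ((1 - theta) * (1 + 3 * theta))%:C by exact: sqr_sqrtc.
have -> (u : R[i]) : (u - w) / 2 * ((u + w) / 2) = (u ^+ 2 - w ^+ 2) / 4 by field.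
rewrite w2 -rmorphXn -rmorphB/=.
have -> : (3 + theta) ^+ 2 - (1 - theta) * (1 + 3 * theta) =
    (theta ^+ 2 + theta + 2) * 4 by ring.
by rewrite rmorphM/= rmorph_nat mulfK// pnatr_eq0.
Qed.

(** The square is real, so the root is real or purely imaginary. In the real case, (1 + theta)^2
    exceeds the square by 4 theta^2. This bound is what places the real parts of [z1] and [z2] above
    1. *)
Lemma Re_sqrtc_bound :
  `|complex.Re (sqrtc ((1 - theta) * (1 + 3 * theta))%:C)| < 1 + theta.
Proof.
set w := sqrtc _.
have : w ^+ 2 = ((1 - theta) * (1 + 3 * theta))%:C by exact: sqr_sqrtc.
case: w => a b /=; rewrite expr2 complexM => -[E1 E2].
have : a * b = 0 by lra.
move/eqP; rewrite mulf_eq0 => /orP[] /eqP H; first by rewrite H normr0 addr_gt0.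
rewrite -(@ltr_pXn2r _ 2)// ?nnegrE ?normr_ge0//; last by rewrite addr_ge0// ltW.
rewrite -normrX ger0_norm ?sqr_ge0//.
by move: E1; rewrite H; have := mulr_gt0 theta_gt0 theta_gt0; nra.
Qed.

Lemma Re_div2 (z : R[i]) : complex.Re (z / 2) = complex.Re z / 2.
Proof.
have -> : 2^-1 = (2^-1)%:C :> R[i] by rewrite fmorphV rmorph_nat.
by case: z => a b /=; rewrite mulr0 subr0.
Qed.

Lemma Re_z1_gt1 : 1 < complex.Re (z1 theta).
Proof.
have := Re_sqrtc_bound; rewrite /z1; move: (sqrtc _) => w.
rewrite Re_div2 raddfB/= ltr_norml; move: (complex.Re w) => a.
lra.
Qed.

Lemma Re_z2_gt1 : 1 < complex.Re (z2 theta).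
Proof.
have := Re_sqrtc_bound; rewrite /z2; move: (sqrtc _) => w.
rewrite Re_div2 raddfD/= ltr_norml; move: (complex.Re w) => a.
lra.
Qed.

(** Factor by factor, with [k] on the left one more than on the right, from the sum and the product
    of [z1] and [z2]. *)
Lemma prod_z1z2 m :
  (\prod_(1 <= k < m.+2) ((k * k.+1)%:R + theta * (theta + k%:R)))%:C =
  (\prod_(k < m.+1) (z1 theta + k%:R)) * (\prod_(k < m.+1) (z2 theta + k%:R)).
Proof.
rewrite big_add1 /= big_mkord rmorph_prod -big_split/=; apply: eq_bigr => k _.
have -> : (z1 theta + k%:R) * (z2 theta + k%:R) =
    z1 theta * z2 theta + (z1 theta + z2 theta) * k%:R + k%:R ^+ 2 by ring.
rewrite z1Mz2 z1Dz2 -(rmorph_nat (real_complex R)) -rmorphXn -!rmorphM -!rmorphD/=.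
congr (_%:C); rewrite natrM -!nat1r; ring.
Qed.

Definition Delta_prob_closed (n : nat) : R :=
  ((n.-1)`!)%:R * (theta ^+ 2 + theta + 2) * rising (theta + 2) (n - 3) /
    ((1 + theta2) * (theta + 2) *
     \prod_(1 <= k < n.-1) ((k * k.+1)%:R + theta * (theta + k%:R))).

Lemma cvg_ratio (a b : R) : 0 < b ->
  (m%:R + a) / (m%:R + b) @[m --> \oo] --> (1 : R).
Proof.
move=> b0.
have H : (m%:R + b)^-1 @[m --> \oo] --> (0 : R).
  apply/gtr0_cvgV0; first by apply: nearW => m; rewrite ltr_wpDl.
  apply/cvgryPge => A; near=> m; rewrite -[A]addr0 lerD ?(ltW b0)//.
  by near: m; exact: nbhs_infty_ger.
have -> : (fun m : nat => (m%:R + a) / (m%:R + b)) =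
    (fun m => 1 + (a - b) * (m%:R + b)^-1).
  apply/funext => m; have : 0 < m%:R + b by rewrite ltr_wpDl.
  by move=> mb; field; rewrite gt_eqF.
rewrite -[X in _ --> X]addr0; apply: cvgD; first exact: cvg_cst.
by rewrite -[X in _ --> X](mulr0 (a - b)); apply: cvgM; [exact: cvg_cst|].
Unshelve. all: by end_near. Qed.

Lemma Delta_prob_closed_cvg : 0 < theta2 ->
  ((Delta_prob_closed n)%:C : R[i]^o) @[n --> \oo] -->
    (((theta ^+ 2 + theta + 2) / (1 + theta2))%:C
       * Beta (z1 theta) (z2 theta) : R[i]^o).
Proof.
move=> theta2_gt0.
(* Gauss's quotient; in [g z1 * g z2 / g (z1 + z2)] the powers of [m] cancel. *)
pose g z m : R[i]^o := cpow m%:R z * (m`!)%:R / \prod_(k < m.+1) (z + k%:R).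
pose K := (theta ^+ 2 + theta + 2) / (1 + theta2).
(* What Gauss's quotients leave over: the numerators come from (m + 2)!/m!, the denominators from
   the last two factors of [rising (theta + 2) m.+2]. *)
pose r m : R :=
  K * ((m%:R + 1) / (m%:R + (theta + 2)) * ((m%:R + 2) / (m%:R + (theta + 3)))).
have r_cvg : r m @[m --> \oo] --> K.
  rewrite -[X in _ --> X]mulr1 -[in X in _ --> X](mulr1 1).
  apply: cvgM; first exact: cvg_cst.
  by apply: cvgM; apply: cvg_ratio; rewrite addr_gt0.
have E m : (Delta_prob_closed (m + 3)%N)%:C =
    (r m)%:C * (g (z1 theta) m * g (z2 theta) m / g (z1 theta + z2 theta) m).
  rewrite /Delta_prob_closed addnK (_ : (m + 3).-1 = m.+2)%N; last lia.
  rewrite fmorph_div !rmorphM/= prod_z1z2 /r /K z1Dz2.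
  set P1 := \prod_(k < _) (z1 theta + _).
  set P2 := \prod_(k < _) (z2 theta + _).
  have Re_n k : complex.Re (k%:R : R[i]) = k%:R by rewrite (raddfMn (@complex.Re R)).
  have P0 (z : R[i]) : 0 < complex.Re z -> \prod_(k < m.+1) (z + k%:R) != 0.
    move=> z0; apply/prodf_neq0 => k _; apply: Re_gt0_neq0.
    by rewrite raddfD/= Re_n ltr_wpDr.
  have P10 : P1 != 0 by apply: P0; apply: lt_trans Re_z1_gt1.
  have P20 : P2 != 0 by apply: P0; apply: lt_trans Re_z2_gt1.
  have P3E : \prod_(k < m.+1) ((3 + theta)%:C + k%:R) =
      (rising (theta + 2) m * (theta + 2 + m%:R) * (theta + 3 + m%:R) /
       (theta + 2))%:C.
    have -> : rising (theta + 2) m * (theta + 2 + m%:R) * (theta + 3 + m%:R) =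
        rising (theta + 2) m.+2.
      by rewrite /rising !big_ord_recr/= -nat1r; ring.
    rewrite /rising [in RHS]big_ord_recl/= addr0 [in RHS]mulrAC.
    rewrite mulfV ?mul1r; last by rewrite gt_eqF// addr_gt0.
    rewrite rmorph_prod; apply: eq_bigr => k _.
    rewrite /bump/= add1n -(rmorph_nat (real_complex R)) -rmorphD/= -nat1r.
    by congr (_%:C); ring.
  rewrite /g -/P1 -/P2 P3E -z1Dz2 cpowD.
  have c1 := cpow_neq0 m%:R (z1 theta); have c2 := cpow_neq0 m%:R (z2 theta).
  have -> : (m.+2)`!%:R = (m%:R + 2) * (m%:R + 1) * m`!%:R :> R.
    by rewrite !factS !natrM -!nat1r; ring.
  have -> : m%:R + (theta + 2) = theta + 2 + m%:R by ring.
  have -> : m%:R + (theta + 3) = theta + 3 + m%:R by ring.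
  rewrite !(rmorphM, fmorphV)/= rmorph_nat.
  have neq0 (x : R) : 0 < x -> x%:C != 0 by move=> x0; rewrite fmorph_eq0 gt_eqF.
  have m0 : 0 <= m%:R :> R by exact: ler0n.
  have f0 : m`!%:R != 0 :> R[i] by rewrite pnatr_eq0 -lt0n fact_gt0.
  have /neq0 : 0 < theta + 2 by rewrite addr_gt0.
  have /neq0 : 0 < theta + 2 + m%:R by rewrite ltr_wpDr ?addr_gt0.
  have /neq0 : 0 < theta + 3 + m%:R by rewrite ltr_wpDr ?addr_gt0.
  have /neq0 : 0 < 1 + theta2 by rewrite addr_gt0.
  have /neq0 : 0 < rising (theta + 2) m.
    by apply: prodr_gt0 => k _; rewrite ltr_wpDr// addr_gt0.
  move: (rising _ _)%:C (1 + theta2)%:C (theta + 3 + m%:R)%:C.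
  move: (theta + 2 + m%:R)%:C (theta + 2)%:C.
  move: (m%:R + 1)%:C (m%:R + 2)%:C (theta ^+ 2 + theta + 2)%:C.
  move=> x1 x2 x3 x4 x5 x6 x7 x8 n4 n5 n6 n7 n8.
  by field; rewrite n4 n5 n6 n7 n8 c1 c2 P10 P20 f0.
have t3 : 1 < 3 + theta by rewrite -[ltLHS]addr0 ltrD// ltr1n.
rewrite -(cvg_shiftn 3).
under eq_fun do rewrite E.
apply: cvgM; first exact: real_complex_cvg.
apply: cvgM; first by apply: cvgM; [exact/Gamma_cvg/Re_z1_gt1|exact/Gamma_cvg/Re_z2_gt1].
apply: cvgV.
  by rewrite z1Dz2; exact: Gamma_real_neq0.
by apply: Gamma_cvg; rewrite z1Dz2.
Qed.

End DeltaLimit.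

(** By [Delta_probS] a step multiplies by [prob0 n.+4 / p n.+3]. Clearing [theta / n.+2] in
    [theta_star], this is (n + 3)(theta + n + 2) over the factor of index [n.+2]: the new factors of
    the factorial, of [rising] and of the product. *)
Lemma Delta_probE (R : realType) (theta theta1 theta2 : R) n :
  0 < theta -> 0 < theta1 -> 0 < theta2 ->
  (3 <= n)%N -> Delta_prob theta theta1 theta2 n = Delta_prob_closed theta theta2 n.
Proof.
move=> h h1 h2; case: n => [|[|[|n]]] // _.
have t1 : theta + 2 != 0 by rewrite gt_eqF// addr_gt0.
have t2 : 1 + theta2 != 0 by rewrite gt_eqF// addr_gt0.
have pos k : 0 < (k * k.+1)%:R + theta * (theta + k%:R).
  by rewrite ltr_wpDl// mulr_gt0// ltr_pwDl.
elim: n => [|n IH].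
  rewrite (Delta_probS _ _ _ h 2)// Delta_prob2 /Delta_prob_closed.
  rewrite /rising big_ord0 big_nat1 /prob0 /play_p /theta_star/=.
  have := pos 1%N; rewrite mul1n => p1.
  have -> : 2`! = 2%N by [].
  have p1' : 2 + theta * (theta + 1) != 0 by rewrite gt_eqF.
  rewrite [2 + theta]addrC.
  have -> : theta ^+ 2 + theta + 2 = 2 + theta * (theta + 1) by ring.
  by field; rewrite t1 t2 p1'.
rewrite (Delta_probS _ _ _ h n.+3)// IH /Delta_prob_closed.
rewrite !subSS !subn0 /rising big_ord_recr /prob0 play_pE// /theta_star.
rewrite [n.+4.-1]/= [n.+3.-1]/= (factS n.+2) natrM.
set Q := \prod_(1 <= k < n.+2) _.
rewrite [X in _ = _ / (_ * X)]big_nat_recr//= -/Q natrM.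
have Q0 : Q != 0 by rewrite gt_eqF// /Q big_nat; apply: prodr_gt0.
have x0 : 0 < n.+2%:R :> R by rewrite ltr0n.
have xt : n.+2%:R + theta != 0 by rewrite gt_eqF// addr_gt0.
have := lt0r_neq0 (pos n.+2).
rewrite natrM -[n.+3%:R]natr1.
have -> : n%:R = n.+2%:R - 2 :> R by rewrite -addn2 natrD addrK.
move: (n.+2%:R) x0 xt => x x0 xt pn; have x1 : x != 0 by rewrite gt_eqF.
by field; rewrite pn Q0 t1 t2 xt x1.
Qed.

Theorem corollary1 (R : realType) (theta theta1 theta2 : R)
  (htheta : 0 < theta)
  (htheta1 : 0 < theta1 <= 1) (htheta2 : 0 < theta2 <= 1)
  (dQ : nat -> measure_display) (TQ : forall n, measurableType (dQ n))
  (Q : forall n, probability (TQ n) R)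
  (eta : forall n : nat, nat -> {RV (Q n) >-> bool})
  (heta : forall n : nat, (2 <= n)%N -> playground_chain theta n (eta n)) :
  let t := theta_star theta theta1 theta2 in
  exists (d : measure_display) (T : measurableType d) (P : probability T R)
    (xi : nat -> {RV P >-> bool}),
  (* existence *)
  [/\ independent_seq xi,
      forall i : nat, (1 <= i)%N -> marginal xi t i
    & represents xi eta] /\
  (* uniqueness in law *)
  (forall (d' : measure_display) (T' : measurableType d')
      (P' : probability T' R) (xi' : nat -> {RV P' >-> bool}),
    independent_seq xi' ->
    (forall i : nat, (1 <= i <= 2)%N -> marginal xi' t i) ->
    represents xi' eta ->
    same_law xi' xi) /\
  (* the probabilities delta_n *)
  (forall n : nat, (3 <= n)%N ->
    delta xi n =
    ((n.-1)`!)%:R * (theta ^+ 2 + theta + 2) * rising (theta + 2) (n - 3) /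
    ((1 + theta2) * (theta + 2) *
     \prod_(1 <= k < n.-1) ((k * k.+1)%:R + theta * (theta + k%:R)))) /\
  delta xi 1 = 0 /\
  delta xi 2 = fine (P (xi 2%N @^-1` [set false])) /\
  delta xi 2 = 1 / (1 + theta2) /\
  (* the limit *)
  ((delta xi n)%:C : R[i]^o) @[n --> \oo] -->
    (((theta ^+ 2 + theta + 2) / (1 + theta2))%:C
       * Beta (z1 theta) (z2 theta) : R[i]^o).
Proof.
move=> t; have /andP[h1 _] := htheta1; have /andP[h2 _] := htheta2.
have s01 i : 0 <= prob0 theta theta1 theta2 i <= 1.
  have /andP[-> s1] := prob0_bound theta theta1 theta2 htheta h1 h2 i.
  exact: ltW.
have [P [xi [ind_xi Ps]]] := exists_bernoulli_seq (prob0 theta theta1 theta2) s01.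
have Ps1 i : (1 <= i)%N ->
    P (xi i @^-1` [set false]) = (prob0 theta theta1 theta2 i)%:E.
  by move=> _; exact: Ps.
have deltaE n : (0 < n)%N -> delta xi n = Delta_prob theta theta1 theta2 n.
  by move=> n0; rewrite /delta (Delta_event_prob theta theta1 theta2 htheta P xi)//.
have deltaE3 n : (3 <= n)%N -> delta xi n = Delta_prob_closed theta theta2 n.
  by move=> n3; rewrite deltaE ?(ltn_trans _ n3)// Delta_probE.
exists _, _, P, xi; split; [|split; [|split; [|split; [|split; [|split]]]]].
- split => //.
  exact: (represents_bernoulli theta theta1 theta2 htheta h1 h2 dQ TQ Q
            eta heta P xi ind_xi Ps1).
- move=> d' T' P' xi' ind' marg' rep'.
  apply: same_law_independent => // i i1; rewrite Ps.
  (* The marginals at 1 and 2 are given and determine all others, hence the law. *)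
  apply: (bernoulli_of_represents theta theta1 theta2 htheta h1 h2 dQ TQ Q
            eta heta P' xi') => //.
    by apply: marg'.
  by apply: marg'.
- exact: deltaE3.
- by rewrite deltaE.
- by rewrite deltaE// Delta_prob2 Ps.
- by rewrite deltaE// Delta_prob2.
(* The closed form is available from [n = 3] on, which suffices for the limit. *)
- apply: cvg_trans (Delta_prob_closed_cvg theta theta2 htheta h2).
  by apply: near_eq_cvg; exists 3%N => // n /= n3; rewrite deltaE3.
Qed.
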